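(* Let $p \in (0, \infty]$ and $q \in (0, \infty)$, and let $\boldsymbol{\sigma} = ((\sigma_{n, i})_{i=1}^n)_{n \in \mathbb{N}} \in \prod_{n \in \mathbb{N}} (0, \infty)^n$ be a triangular array of positive reals; write $\sigma_n := (\sigma_{n,i})_{i=1}^n$. Assume that the limit $$F_{q, \boldsymbol{\sigma}} := \lim_{n \to \infty}\biggl[ \biggl( \prod_{i = 1}^n \sigma_{n, i} \biggr)^{\frac{1}{n}} \biggl( \frac{1}{n} \sum_{i = 1}^n \sigma_{n, i}^{-q} \biggr)^{\frac{1}{q}} \biggr]$$ exists in $[0, \infty]$ and that $$\lim_{n \to \infty} \biggl[ \biggl( \prod_{i = 1}^n \sigma_{n, i} \biggr)^{\frac{2 q}{n}} \frac{1}{n^2} \sum_{i = 1}^n \sigma_{n, i}^{-2 q} \biggr] = 0.$$ Define $$A_{p, q} := M_p(q)^{-\frac{1}{q}} \lim_{n \to \infty} \frac{n^{-\frac{1}{q}} \, r_{n, q}}{n^{-\frac{1}{p}} \, r_{n, p}} = \begin{cases} \dfrac{\Gamma(1 + \frac{1}{p})^{1 + 1/q}}{\Gamma(1 + \frac{1}{q})\, \Gamma(\frac{q + 1}{p})^{1/q}} \, e^{\frac{1}{p} - \frac{1}{q}} \, \bigl( \frac{p}{q} \bigr)^{\frac{1}{q}} & \text{if } p < \infty,\\[2mm] \dfrac{1}{\Gamma(1 + \frac{1}{q})} \bigl( \frac{q + 1}{q e} \bigr)^{\frac{1}{q}} & \text{if } p = \infty. \end{cases}$$ Then, for all $t \in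 [0, \infty)$, $$\lim_{n \to \infty} \operatorname{vol}_n\bigl(\mathbb{D}_p^n \cap t\, \widetilde{\mathcal{E}}_{q, \sigma_n}^n\bigr) = \begin{cases} 0 & \text{if } t A_{p, q} < F_{q, \boldsymbol{\sigma}},\\ 1 & \text{if } t A_{p, q} > F_{q, \boldsymbol{\sigma}}. \end{cases}$$
   Context: For $0<p\le\infty$ and $x\in\mathbb{R}^n$: $\lVert x\rVert_p := (\sum_{i=1}^n |x_i|^p)^{1/p}$ if $p<\infty$ and $\lVert x\rVert_\infty := \max_i |x_i|$. $\mathbb{B}_p^n := \{x\in\mathbb{R}^n : \lVert x\rVert_p\le 1\}$; $\operatorname{vol}_n$ is $n$-dimensional Lebesgue measure; $r_{n,p} := \operatorname{vol}_n(\mathbb{B}_p^n)^{-1/n}$ and $\mathbb{D}_p^n := r_{n,p}\mathbb{B}_p^n$ is the ball normalized to volume one. For $\sigma=(\sigma_1,\dots,\sigma_n)\in(0,\infty)^n$, the $p$-ellipsoid with semi-axes $\sigma_1,\dots,\sigma_n$ is $\mathcal{E}_{p,\sigma}^n := \{x\in\mathbb{R}^n : \sum_{i=1}^n |x_i/\sigma_i|^p\le 1\}$ for $p<\infty$ and $\mathcal{E}_{\infty,\sigma}^n := \{x \in\mathbb{R}^n: \max_{i} |x_i/\sigma_i|\le 1\}$. Its unit-volume dilation is $\widetilde{\mathcal{E}}_{p,\sigma}^n := \operatorname{vol}_n(\mathcal{E}_{p,\sigma}^n)^{-1/n}\,\mathcal{E}_{p,\sigma}^n$. The $p$-Gaussian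 distribution $\gamma_p$ on $\mathbb{R}$ has density $\frac{1}{2p^{1/p}\Gamma(\frac1p+1)}e^{-|x|^p/p}$ if $p<\infty$, and $\frac12 1_{[-1,1]}(x)$ if $p=\infty$. For $X\sim\gamma_p$, $M_p(q) := \mathbb{E}[|X|^q]$. Convention: $1/\infty=0$. *)

(* Defs.v *)
From HB Require Import structures.
From mathcomp Require Import all_boot all_order all_algebra.
From mathcomp Require Import all_classical all_reals all_analysis.
From mathcomp Require Import measurable_realfun.

Set Implicit Arguments.
Unset Strict Implicit.
Unset Printing Implicit Defensive.

Import Order.TTheory GRing.Theory Num.Theory.
Import numFieldNormedType.Exports.

Local Open Scope classical_set_scope.
Local Open Scope ring_scope.

(* Setting: MathComp-Analysis over an arbitrary R : realType.  R^n is the type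
   n.-tuple R with the library's product sigma-algebra.  An exponent in
   ]0, +oo] is a p : \bar R with 0 < p; in definitions by cases on p, the value
   at -oo is irrelevant. *)

Section as_sigma_finite.
Context d (T : measurableType d) (R : realType) (mu : {measure set T -> \bar R}).
Hypothesis mu_sigma_finite : sigma_finite setT mu.

Let nu : set T -> \bar R := mu.

HB.instance Definition _ := Measure.on nu.
HB.instance Definition _ :=
  Measure_isSigmaFinite.Build _ _ _ nu mu_sigma_finite.

Definition as_sigma_finite : {sigma_finite_measure set T -> \bar R} := nu.
End as_sigma_finite.

Section volume.
Context {R : realType}.

Definition tcons n (xt : measurableTypeR R * n.-tuple R) : n.+1.-tuple R :=
  [tuple of xt.1 :: xt.2].

(* n-dimensional Lebesgue measure, as an iterated product of one-dimensional
   ones; lemma vol_box below gives its value on boxes. *)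
Fixpoint vol n : set (n.-tuple R) -> \bar R :=
  if n is m.+1 then pushforward (lebesgue_measure \x @vol m)%E (@tcons m)
  else \d_([tuple] : 0.-tuple R).

Lemma measurable_tcons n : measurable_fun setT (@tcons n).
Proof.
by apply: measurable_cons; [exact: measurable_fst|exact: measurable_snd].
Qed.

Definition tuncons n (x : n.+1.-tuple R) : measurableTypeR R * n.-tuple R :=
  (thead x, [tuple of behead x]).

Lemma measurable_tuncons n : measurable_fun setT (@tuncons n).
Proof.
apply/measurable_fun_pairP; split; last exact: measurable_behead.
exact: (@measurable_tnth _ _ n.+1 ord0).
Qed.

Lemma tconsK n : cancel (@tcons n) (@tuncons n).
Proof. by case=> x t; congr pair; exact/val_inj. Qed.

Lemma vol_spec n : exists mu : {sigma_finite_measure set (n.-tuple R) -> \bar R},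
  @vol n = mu :> (set (n.-tuple R) -> \bar R).
Proof.
elim: n => [|n [mu IH]]; first by exists (\d_([tuple] : 0.-tuple R)).
pose leb : {sigma_finite_measure set (measurableTypeR R) -> \bar R} :=
  lebesgue_measure.
pose m2 : {measure set _ -> \bar R} := (leb \x mu)%E.
have nu_sf : sigma_finite setT (pushforward m2 (@tcons n)).
  have /sigma_finiteP[F [FT ndF Foo]] := sigma_finiteT leb.
  have /sigma_finiteP[G [GT ndG Goo]] := sigma_finiteT mu.
  exists (fun k => @tuncons n @^-1` (F k `*` G k)).
    rewrite -preimage_bigcup; apply/seteqP; split => // x _ /=.
    have [i _ Fi] : (\bigcup_i F i) (tuncons x).1 by rewrite -FT.
    have [j _ Gj] : (\bigcup_i G i) (tuncons x).2 by rewrite -GT.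
    exists (maxn i j) => //; split.
    - by move: Fi; exact/subsetPset/ndF/leq_maxl.
    - by move: Gj; exact/subsetPset/ndG/leq_maxr.
  move=> k; have [mF Fk] := Foo k; have [mG Gk] := Goo k; split.
    by rewrite -[X in measurable X]setTI; apply: measurable_tuncons => //;
      exact: measurableX.
  rewrite /pushforward -comp_preimage (_ : _ \o _ = id); last first.
    by apply/funext => x /=; rewrite tconsK.
  rewrite preimage_id /m2 /= product_measure1E//.
  by rewrite lte_mul_pinfty// ge0_fin_numE.
have [pf pfE] : exists pf : {measure set (n.+1.-tuple R) -> \bar R},
    pushforward m2 (@tcons n) = pf :> (set (n.+1.-tuple R) -> \bar R).
  pose pf0 : {measure set (n.+1.-tuple R) -> \bar R} :=
    pushforward m2 (@tcons n).
  by exists (pf0 (@measurable_tcons n)).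
rewrite pfE in nu_sf.
by exists (as_sigma_finite nu_sf); rewrite /= IH.
Qed.

Lemma vol0 n : @vol n set0 = 0%E.
Proof. by have [mu ->] := vol_spec n; rewrite measure0. Qed.

Lemma vol_ge0 n A : (0 <= @vol n A)%E.
Proof. by have [mu ->] := vol_spec n; exact: measure_ge0. Qed.

Lemma vol_sigma_additive n : semi_sigma_additive (@vol n).
Proof. by have [mu ->] := vol_spec n; exact: measure_semi_sigma_additive. Qed.

HB.instance Definition _ n := isMeasure.Build _ _ _ (@vol n)
  (@vol0 n) (@vol_ge0 n) (@vol_sigma_additive n).

Lemma vol_sigma_finite n : sigma_finite setT (@vol n).
Proof. by have [mu ->] := vol_spec n; exact: sigma_finiteT. Qed.

HB.instance Definition _ n := Measure_isSigmaFinite.Build _ _ _ (@vol n)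
  (@vol_sigma_finite n).

Lemma vol_box n (a b : n.-tuple R) : (forall i, tnth a i <= tnth b i) ->
  vol [set x | forall i, tnth a i <= tnth x i <= tnth b i] =
  (\prod_(i < n) (tnth b i - tnth a i))%:E.
Proof.
elim: n a b => [|n IH] a b ab.
  by rewrite big_ord0 /= diracE mem_set//= => -[].
case/tupleP: a ab => a1 a; case/tupleP: b => b1 b ab.
pose B := [set x : n.-tuple R | forall i, tnth a i <= tnth x i <= tnth b i].
transitivity ((lebesgue_measure \x @vol n)%E (`[a1, b1] `*` B)).
  rewrite /= /pushforward; congr (_ _).
  apply/seteqP; split => [[x t] /= H|[x t] /= [+ H] i].
    split; first by have := H ord0; rewrite !tnth0 in_itv.
    by move=> i; have := H (lift ord0 i); rewrite !tnthS.
  rewrite in_itv/= => abx.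
  by case: (unliftP ord0 i) => [j|] ->; rewrite ?tnthS ?tnth0.
rewrite product_measure1E//=; last first.
  rewrite (_ : B =
      \bigcap_(i in [set: 'I_n]) ((@tnth _ R)^~ i @^-1` `[tnth a i, tnth b i])).
    apply: fin_bigcap_measurable => // i _.
    by rewrite -[X in measurable X]setTI; exact: measurable_tnth.
  apply/seteqP; split => x /= H i; first by move=> _ /=; rewrite in_itv/=.
  by have := H i I; rewrite /= in_itv.
rewrite IH; last by move=> i; have := ab (lift ord0 i); rewrite !tnthS.
rewrite lebesgue_measure_itv/= lte_fin big_ord_recl/= !tnth0.
under [in RHS]eq_bigr do rewrite !tnthS.
have := ab ord0; rewrite !tnth0 le_eqVlt => /predU1P[->|->].
  by rewrite ltxx mul0e subrr mul0r.
by rewrite -EFinB EFinM.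
Qed.

End volume.

Section balls.
Context {R : realType}.
Implicit Types (p : \bar R) (n : nat).

Definition pnorm p n (x : n.-tuple R) : R :=
  if p is r%:E then (\sum_(i < n) `|tnth x i| `^ r) `^ r^-1
  else \big[Num.max/0]_(i < n) `|tnth x i|.

Definition pball n p : set (n.-tuple R) := [set x | pnorm p x <= 1].

Definition dilate n (t : R) (A : set (n.-tuple R)) : set (n.-tuple R) :=
  [set [tuple t * tnth x i | i < n] | x in A].

(* The factor vol_n(A)^(-1/n), for A of finite volume. *)
Definition unit_vol_factor n (A : set (n.-tuple R)) : R :=
  fine (vol A) `^ (- n%:R^-1).

Definition pradius n p : R := unit_vol_factor (@pball n p).

Definition unit_pball n p : set (n.-tuple R) :=
  dilate (pradius n p) (@pball n p).

Definition pellipsoid n p (sigma : n.-tuple R) : set (n.-tuple R) :=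
  if p is r%:E then
    [set x | \sum_(i < n) `|tnth x i / tnth sigma i| `^ r <= 1]
  else [set x | \big[Num.max/0]_(i < n) `|tnth x i / tnth sigma i| <= 1].

Definition unit_pellipsoid n p (sigma : n.-tuple R) : set (n.-tuple R) :=
  dilate (unit_vol_factor (pellipsoid p sigma)) (pellipsoid p sigma).

End balls.

Arguments pball {R} n p.
Arguments unit_pball {R} n p.
Arguments pradius {R} n p.

Section pgaussian.
Context {R : realType}.
Implicit Types p : \bar R.

(* Euler's Gamma function, for x > 0. *)
Definition Gamma (x : R) : R :=
  \int[lebesgue_measure]_(t in `]0, +oo[) (t `^ (x - 1) * expR (- t)).

Definition pgauss_pdf p (x : R) : R :=
  if p is r%:E then
    (2 * r `^ r^-1 * Gamma (r^-1 + 1))^-1 * expR (- (`|x| `^ r / r))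
  else 2^-1 * \1_(`[-1, 1]) x.

Definition pgauss p : set (measurableTypeR R) -> \bar R :=
  fun V => (\int[lebesgue_measure]_(x in V) (pgauss_pdf p x)%:E)%E.

Lemma Gamma_ge0 x : 0 <= Gamma x.
Proof. by apply: Rintegral_ge0 => t _; rewrite mulr_ge0 ?powR_ge0 ?expR_ge0. Qed.

Lemma pgauss_pdf_ge0 p x : (0 <= (pgauss_pdf p x)%:E)%E.
Proof.
rewrite lee_fin /pgauss_pdf; case: p => [r| |].
- by rewrite mulr_ge0 ?expR_ge0// invr_ge0 !mulr_ge0 ?powR_ge0 ?Gamma_ge0.
- by rewrite mulr_ge0 ?invr_ge0// indicE.
- by rewrite mulr_ge0 ?invr_ge0// indicE.
Qed.

Lemma measurable_pgauss_pdf p : measurable_fun [set: R] (pgauss_pdf p).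
Proof.
rewrite /pgauss_pdf; case: p => [r| |];
  apply: measurable_funM => //; try exact: measurable_indic.
apply: measurableT_comp => //; apply: measurableT_comp => //.
apply: measurable_funM => //.
by apply: (measurableT_comp (measurable_powR _)); exact: normr_measurable.
Qed.

Lemma pgauss0 p : pgauss p set0 = 0%E.
Proof. by rewrite /pgauss integral_set0. Qed.

Lemma pgauss_ge0 p A : (0 <= pgauss p A)%E.
Proof. by apply: integral_ge0 => x _; exact: pgauss_pdf_ge0. Qed.

Lemma pgauss_sigma_additive p : semi_sigma_additive (pgauss p).
Proof.
apply: semi_sigma_additive_nng_induced; last exact: pgauss_pdf_ge0.
by apply/measurable_EFinP; exact: measurable_pgauss_pdf.
Qed.

HB.instance Definition _ p := isMeasure.Build _ _ _ (pgauss p)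
  (pgauss0 p) (@pgauss_ge0 p) (@pgauss_sigma_additive p).

(* E[|X|^q] for X distributed according to the p-Gaussian measure. *)
Definition pgauss_moment p (q : R) : R := \int[pgauss p]_x (`|x| `^ q).

End pgaussian.

Section constant.
Context {R : realType}.
Implicit Types (p : \bar R) (q : R).

(* (p^-1)%E is 0 for p = +oo, so fine (p^-1)%E is 1/p with 1/oo = 0. *)
Definition radius_ratio p q (n : nat) : R :=
  (n%:R `^ (- q^-1) * pradius n q%:E) /
  (n%:R `^ (- fine (p^-1)%E) * pradius n p).

Definition Apq p q : R :=
  pgauss_moment p q `^ (- q^-1) * limn (radius_ratio p q).

Definition Apq_formula p q : R :=
  if p is r%:E then
    Gamma (1 + r^-1) `^ (1 + q^-1) /
      (Gamma (1 + q^-1) * Gamma ((q + 1) / r) `^ q^-1)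
    * expR (r^-1 - q^-1) * (r / q) `^ q^-1
  else (Gamma (1 + q^-1))^-1 * ((q + 1) / (q * expR 1)) `^ q^-1.

End constant.

(* Main.v *)
(* The p-Gaussian product measure depends on x only through the p-norm, so the
   layer-cake formula e^(-s) = int_0^oo 1_[s <= u] e^(-u) du shows that it gives
   to every measurable cone the same mass as the uniform distribution on the
   p-ball (no formula for the volume of the ball is needed). For p = oo the two
   measures simply coincide. Since almost all of the volume of the p-ball lies
   near its boundary, the weak law of large numbers (Chebyshev) for sums of
   |X_i|^q and |X_i|^p transfers from the product measure to the ball. The
   volume in the theorem is, after rescaling, the proportion of the p-ball where
   such a weighted q-sum is at most (t * radius_ratio p q n)^q.
   The limit of n^(-1/p) r_(n,p) also comes from the law of large numbers: on
   {sum |x_i|^p ~ n} the density is roughly c^n e^(-n/p), whence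
   vol (n^(1/p) B_p) ~ (e^(1/p) / c)^n up to subexponential factors; this
   replaces Stirling's formula. *)
Require Import Defs.
From mathcomp Require Import all_boot all_order all_algebra.
From mathcomp Require Import all_classical all_reals all_analysis.
From mathcomp Require Import measurable_realfun.
From mathcomp Require Import ring lra.

Set Implicit Arguments.
Unset Strict Implicit.
Unset Printing Implicit Defensive.

Import Order.TTheory GRing.Theory Num.Theory.
Import numFieldNormedType.Exports.

Local Open Scope classical_set_scope.
Local Open Scope ring_scope.

(** * One-dimensional integrals and the Gamma function *)

Section one_dim.
Context {R : realType}.
Local Notation leb := (@lebesgue_measure R).

(** For finite [p], the event that the weighted q-sum lies below a fixed threshold is not a cone, so
    the mass identity for cones does not apply to it. It is traded for the event comparing the q-sum
    with a multiple of the (q/p)-th power of the mean of [|x_i|^p]: both sides scale like [a^q]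
    under dilation by [a], and this mean concentrates at 1. Every such trade costs a constant
    factor, paid for by the gap that the strict inequality between [t * Apq p q] and [F] leaves
    between threshold and mean. The two directions are not symmetric. For large values of the q-sum,
    the bound [sum |x_i|^p <= 1] on the ball already gives the homogeneous event. For small values,
    a slightly shrunken ball has to be discarded, and this is where concentration near the boundary
    enters. The bounds on thresholds and sums of weights are one-sided and eventual, so that
    [F = +oo] needs no separate argument. *)

Lemma integral_itvy_expRN (s : R) :
  (\int[leb]_(u in `[s, +oo[) (expR (- u))%:E = (expR (- s))%:E)%E.
Proof.
have dF (x : R) : is_derive x 1 (fun u : R => - expR (- u)) (expR (- x)).
  by apply: is_derive_eq; rewrite mulrN1 opprK.
have cF : continuous (fun u : R => expR (- u)).
  by move=> x; apply: continuous_comp; [exact: opp_continuous|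
    exact: continuous_expR].
rewrite (@ge0_continuous_FTC2y R (fun u => expR (- u)) (fun u =>
  - expR (- u)) s 0)//.
- by rewrite sub0e EFinN oppeK.
- exact: continuous_subspaceT.
- by rewrite -oppr0; apply: cvgN; exact: cvgr_expR.
- by apply: cvg_at_right_filter; apply: cvgN; exact: cF.
- by move=> x _; rewrite derive1E derive_val.
Qed.

(** Tonelli applied to [expR (- u)] on the region [g x <= u]. The factor [h] is left free because
    there are two uses: a power of [x] on the positive half-line yields Gamma integrals, and the
    indicator of a cone yields volumes inside balls. *)
Lemma layer_cake d (T : measurableType d)
    (m : {sigma_finite_measure set T -> \bar R}) (g : T -> R) (h : T -> \bar R)
      :
  measurable_fun setT g -> measurable_fun setT h ->
  (forall x, 0 <= g x) -> (forall x, 0 <= h x)%E ->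
  (\int[m]_x (h x * (expR (- g x))%:E) =
   \int[leb]_(u in `]0%R, +oo[)
     ((expR (- u))%:E * \int[m]_(x in [set x | (g x <= u)%R]) h x))%E.
Proof.
move=> mg mh g0 h0.
pose A : set (T * measurableTypeR R) := [set z | g z.1 <= z.2].
have mA : measurable A.
  rewrite /A -[X in measurable X]setTI; apply: measurable_fun_le => //.
  exact: measurableT_comp.
pose f (z : T * measurableTypeR R) : \bar R :=
  (h z.1 * (expR (- z.2) * \1_A z)%:E)%E.
have mE : measurable_fun [set: measurableTypeR R] (fun u : R => expR (- u)).
  by apply: continuous_measurable_fun => x; apply: continuous_comp;
    [exact: opp_continuous|exact: continuous_expR].
have mf : measurable_fun setT f.
  apply: emeasurable_funM; first exact: measurableT_comp.
  apply/measurable_EFinP; apply: measurable_funM; last exact: measurable_indic.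
  exact: (measurableT_comp mE).
have f0 z : (0 <= f z)%E by rewrite mule_ge0// lee_fin mulr_ge0 ?expR_ge0.
have := @fubini_tonelli _ _ _ _ _ m leb f mf f0.
rewrite (_ : (fun x => _)%E = (fun x => h x * (expR (- g x))%:E)%E); last first.
  apply/funext => x.
  rewrite -integral_itvy_expRN -ge0_integralZl//; first last.
  - by apply/measurable_funTS; exact/measurable_EFinP.
  rewrite [RHS]integral_mkcond.
  apply: eq_integral => u _; rewrite /f patchE indicE/=.
  rewrite (_ : ((x, u) \in A) = (u \in `[g x, +oo[)); last first.
    by rewrite in_itv/= andbT /A; apply/idP/idP; rewrite in_setE.
  rewrite mem_setE; case: ifPn; rewrite ?mulr1// mulr0 mule0//.
move=> ->.
pose F u : \bar R :=
  ((expR (- u))%:E * \int[m]_(x in [set x | (g x <= u)%R]) h x)%E.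
(* For [u < 0] the sublevel set is empty since [g >= 0], so the outer integral lives on the
   half-line; dropping the endpoint 0 needs measurability in [u], which Tonelli supplies. *)
suff key u : (\int[m]_x f (x, u))%E = (F \_ `[0, +oo[) u.
  under eq_integral do rewrite key.
  rewrite -integral_mkcond -integral_itv_obnd_cbnd//.
  pose G := fubini_G m f.
  apply: (@eq_measurable_fun _ _ _ _ _ G); last first.
    apply: measurable_funTS.
    exact: (measurable_fun_fubini_tonelli_G (m1 := m) f mf f0).
  move=> u /[!inE] u0.
  rewrite /G /fubini_G key patchE mem_set//=.
  by move: u0; rewrite /= !in_itv/= !andbT => /ltW.
have mgu : measurable [set x | g x <= u].
  rewrite -[X in measurable X]setTI; exact: measurable_fun_le.
have fE x : f (x, u) = ((expR (- u))%:E * (h \_ [set x | (g x <= u)%R]) x)%E.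
  rewrite /f patchE indicE/= muleC.
  rewrite (_ : ((x, u) \in A) = (x \in [set x | g x <= u])); last first.
    by apply/idP/idP; rewrite !in_setE.
  by case: ifPn => _; rewrite ?mulr1// !(mulr0, mule0, mul0e).
under eq_integral do rewrite fE.
rewrite ge0_integralZl//; first last.
- by move=> x _; apply: erestrict_ge0.
- by apply/measurable_restrict => //; apply/measurable_funTS.
rewrite -integral_mkcond patchE mem_setE in_itv/= andbT /F.
case: ifPn => //; rewrite -ltNge => u0.
rewrite (_ : [set x | g x <= u] = set0) ?integral_set0 ?mule0//.
apply/seteqP; split => // x /= /(le_trans (g0 x)).
by rewrite leNgt u0.
Qed.

Lemma continuous_powR (a x : R) : 0 < x -> {for x, continuous (@powR R ^~ a)}.
Proof.
move=> x0; apply/differentiable_continuous/derivable1_diffP.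
by apply: derivable_powR; rewrite in_itv/= andbT.
Qed.

(** For [a < 1] the integrand is unbounded near 0, so the fundamental theorem of calculus is used on
    intervals away from 0, and monotone convergence does the rest. *)
Lemma integral_itvoc_powR (a b : R) : 0 < a -> 0 <= b ->
  (\int[leb]_(x in `]0%R, b]) (x `^ (a - 1))%:E = (b `^ a / a)%:E)%E.
Proof.
move=> a0; rewrite le_eqVlt => /predU1P[<-|b0].
  by rewrite set_itvoc0 integral_set0 powR0 ?gt_eqF// mul0r.
(* The shift by 2 keeps even [e 0] strictly below [b]. *)
pose e (k : nat) := b * (k.+2%:R)^-1.
have e0 k : 0 < e k by rewrite mulr_gt0.
have eb k : e k < b by rewrite ltr_pdivrMr// ltr_pMr// ltr1n.
pose E (k : nat) : set (measurableTypeR R) := `[e k, b]%classic.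
have FTC k : (\int[leb]_(x in E k) (x `^ (a - 1))%:E =
    (b `^ a / a - e k `^ a / a)%:E)%E.
  have pos x : x \in `[e k, b] -> 0 < x.
    by rewrite in_itv/= => /andP[+ _]; exact: lt_le_trans.
  have dF (x : R) : 0 < x -> is_derive x 1 (fun x : R =>
    x `^ a / a) (x `^ (a - 1)).
    move=> x0; have d := is_derive1_powR a x0.
    apply: is_derive_eq.
    by rewrite scaler0 add0r /GRing.scale/= mulrA mulVf ?gt_eqF// mul1r.
  rewrite /E (@continuous_FTC2 _ _ (fun x => x `^ a / a))//.
  - apply: derivable_within_continuous => x /pos x0.
    by apply: derivable_powR; rewrite in_itv/= andbT.
  - split.
    + move=> x xI; have x0 := pos _ (subset_itv_oo_cc xI).
      by have := dF _ x0; move=> [].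
    + by apply: cvg_at_right_filter; apply: cvgMl; exact: continuous_powR.
    + by apply: cvg_at_left_filter; apply: cvgMl; exact: continuous_powR.
  - move=> x xI; have x0 := pos _ (subset_itv_oo_cc xI).
    by rewrite derive1E; have := dF _ x0; move=> [].
have UE : \bigcup_k E k = `]0, b]%classic.
  apply/seteqP; split=> [x [k _]|x]; rewrite /E/= !in_itv/=.
    by move=> /andP[/(lt_le_trans (e0 k)) -> ->].
  move=> /andP[x0 xb].
  exists (Num.truncn (b / x)) => //; rewrite /E/= in_itv/= xb andbT.
  rewrite ler_pdivrMr// mulrC -ler_pdivrMr//.
  by rewrite (le_trans (ltW (truncnS_gt _)))// ler_nat.
have : (\int[leb]_(x in E k) (x `^ (a - 1))%:E)%E @[k --> \oo] -->
    (\int[leb]_(x in \bigcup_k E k) (x `^ (a - 1))%:E)%E.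
  apply: ge0_nondecreasing_set_cvg_integral => //.
  - move=> m k mk; apply/subsetPset => x; rewrite /E/= !in_itv/= =>
      /andP[ex ->].
    rewrite andbT (le_trans _ ex)//.
    by rewrite ler_pM2l// lef_pV2 ?posrE// ler_nat.
  - by move=> k; rewrite /E; exact: measurable_itv.
  - by move=> k; apply: measurable_funTS; apply/measurable_EFinP;
      exact: measurable_powR.
  - by move=> k x _; rewrite lee_fin powR_ge0.
rewrite UE => /cvg_unique; apply => //.
rewrite /mkset.
under eq_fun do rewrite FTC.
apply: cvg_EFin; first exact: nearW.
rewrite [X in _ --> X](_ : _ = b `^ a / a - 0 / a); last by rewrite mul0r subr0.
apply: cvgB; first exact: cvg_cst.
apply: cvgMl.
have /cvg_at_rightP := powR_cvg0 a0; apply; split => //.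
rewrite -[X in _ --> X](mulr0 b); apply: cvgMr.
by rewrite (cvg_shiftS (@harmonic R)); exact: cvg_harmonic.
Qed.

(** Extended-real values allow the functional equation to be proved before finiteness, which is then
    deduced from it. *)
Definition eGamma (x : R) : \bar R :=
  (\int[leb]_(t in `]0%R, +oo[) (t `^ (x - 1) * expR (- t))%:E)%E.

Lemma eGamma_ge0 x : (0 <= eGamma x)%E.
Proof.
by apply: integral_ge0 => t _; rewrite lee_fin mulr_ge0 ?powR_ge0 ?expR_ge0.
Qed.

(** The layer cake stands in for the substitution [u = x^r / r]: the sublevel sets are the intervals
    from 0 to [(r u)^(1/r)], and integrating the power over them gives a multiple of [u^(a/r)],
    hence the argument [a / r + 1]. *)
Lemma integral_powR_expRN (a r : R) : 0 < a -> 0 < r ->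
  (\int[leb]_(x in `]0%R, +oo[) (x `^ (a - 1) * expR (- (`|x| `^ r / r)))%:E =
   (r `^ (a / r) / a)%:E * eGamma (a / r + 1))%E.
Proof.
move=> a0 r0.
pose h : R -> \bar R := (fun x : R => (x `^ (a - 1))%:E) \_ `]0, +oo[.
have mh : measurable_fun [set: measurableTypeR R] h.
  apply/measurable_restrict => //.
  apply: measurable_funTS; apply/measurable_EFinP; exact: measurable_powR.
have h0 x : (0 <= h x)%E.
  by apply: erestrict_ge0 => y _; rewrite lee_fin powR_ge0.
have mg : measurable_fun [set: measurableTypeR R] (fun x : R => `|x| `^ r / r).
  apply: measurable_funM => //.
  by apply: (measurableT_comp (measurable_powR _)); exact: normr_measurable.
have g0 (x : R) : 0 <= `|x| `^ r / r by rewrite divr_ge0 ?powR_ge0 ?ltW.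
have := @layer_cake _ _ leb _ _ mg mh g0 h0.
rewrite (_ : (\int[_]_x _)%E = (\int[leb]_(x in `]0%R, +oo[)
    (x `^ (a - 1) * expR (- (`|x| `^ r / r)))%:E)%E); last first.
  rewrite [RHS]integral_mkcond; apply: eq_integral => x _.
  by rewrite /h !patchE; case: ifPn => _; rewrite ?mul0e// EFinM.
move=> ->.
rewrite /eGamma -ge0_integralZl//; first last.
- by rewrite lee_fin divr_ge0 ?powR_ge0 ?ltW.
- by move=> t _; rewrite lee_fin mulr_ge0 ?powR_ge0 ?expR_ge0.
- apply: measurable_funTS; apply/measurable_EFinP; apply: measurable_funM.
    exact: measurable_powR.
  apply: continuous_measurable_fun => x; apply: continuous_comp;
    [exact: opp_continuous|exact: continuous_expR].
apply: eq_integral => u; rewrite inE/= in_itv/= andbT => u0.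
have ru0 : 0 < r * u by rewrite mulr_gt0.
have -> : (\int[leb]_(x in [set x : R | (`|x| `^ r / r <= u)%R]) h x =
    \int[leb]_(x in `]0%R, ((r * u) `^ r^-1)%R]) (x `^ (a - 1))%:E)%E.
  rewrite [LHS]integral_mkcond [RHS]integral_mkcond; apply: eq_integral => x _.
  rewrite /h !patchE !mem_setE !in_itv/= andbT.
  have [x0|_] /= := ltP 0 x; last by case: ifP.
  congr (if _ then _ else _).
  rewrite [LHS](_ : _ = (`|x| `^ r / r <= u))// gtr0_norm// ler_pdivrMr//
    [u * r]mulrC.
  have xE : x = (x `^ r) `^ r^-1 by rewrite -powRrM mulfV ?gt_eqF// powRr1 ?ltW.
  have ruE : r * u = ((r * u) `^ r^-1) `^ r.
    by rewrite -powRrM mulVf ?gt_eqF// powRr1 ?ltW.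
  apply/idP/idP => xu.
    by rewrite xE ge0_ler_powR ?invr_ge0 ?nnegrE ?powR_ge0// ltW.
  by rewrite ruE ge0_ler_powR ?nnegrE ?powR_ge0// ltW.
rewrite integral_itvoc_powR ?powR_ge0// -!EFinM; congr EFin.
rewrite -powRrM powRM ?ltW// [r^-1 * a]mulrC addrK. ring.
Qed.
(** The case [r = 1] of the preceding identity, in place of an integration by parts. *)
Lemma eGammaS (x : R) : 0 < x -> eGamma (x + 1) = (x%:E * eGamma x)%E.
Proof.
move=> x0; have := @integral_powR_expRN x 1 x0 ltr01.
rewrite powR1 divr1 mul1r.
have -> : (\int[leb]_(x0 in `]0%R, +oo[) (x0 `^ (x - 1) * expR (- (`|x0| `^ 1 /
  1)))%:E =
  eGamma x)%E.
  apply: eq_integral => t; rewrite inE/= in_itv/= andbT => t0.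
  by rewrite powRr1// divr1 gtr0_norm.
by move=> ->; rewrite muleA -EFinM mulfV ?gt_eqF// mul1e.
Qed.
Lemma measurable_powR_expRN (s : R) :
  measurable_fun [set: measurableTypeR R] (fun t : R => t `^ s * expR (- t)).
Proof.
apply: measurable_funM; first exact: measurable_powR.
apply: continuous_measurable_fun => x; apply: continuous_comp;
  [exact: opp_continuous|exact: continuous_expR].
Qed.

(** The inequality [y <= expR y] at [y = t / (2 * s)], raised to the power [s]. The rate 1/2 leaves
    half of the decay of [expR (- t)] for integrability. *)
Lemma powR_le_expR (s t : R) : 0 < s -> 0 <= t ->
  t `^ s <= (2 * s) `^ s * expR (t / 2).
Proof.
move=> s0 t0; have s20 : 0 < 2 * s by rewrite mulr_gt0.
have -> : expR (t / 2) = expR (t / (2 * s)) `^ s.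
  rewrite /powR gt_eqF ?expR_gt0// expRK; congr expR; field; exact: lt0r_neq0.
rewrite -powRM ?expR_ge0 ?(ltW s20)// ge0_ler_powR ?nnegrE ?(ltW s0)//.
  by rewrite mulr_ge0 ?expR_ge0 ?(ltW s20).
rewrite mulrC -ler_pdivrMr// (le_trans _ (expR_ge1Dx _))//.
by rewrite lerDr ler01.
Qed.

(** At [y + 1] the integrand is dominated by a multiple of the exponential density of rate 1/2, the
    leading 2 cancelling its normalisation. The functional equation then excludes an infinite value
    at [x]. *)
Lemma eGamma_lty (x : R) : 0 < x -> (eGamma x < +oo)%E.
Proof.
have gt1 (y : R) : 0 < y -> (eGamma (y + 1) < +oo)%E.
  move=> y0; rewrite /eGamma addrK.
  have r20 : 0 < 2^-1 :> R by rewrite invr_gt0.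
  apply: (@le_lt_trans _ _
    ((2 * (2 * y) `^ y)%:E * \int[leb]_t (exponential_pdf 2^-1 t)%:E)%E);
      last first.
    by rewrite integral_exponential_pdf// mule1 ltry.
  rewrite -ge0_integralZl//; first last.
  - by rewrite lee_fin mulr_ge0 ?powR_ge0.
  - by move=> t _; rewrite lee_fin exponential_pdf_ge0// ltW.
  - by apply/measurable_EFinP; exact: measurable_exponential_pdf.
  rewrite [leLHS]integral_mkcond; apply: ge0_le_integral => //.
  - by move=> t _; apply: erestrict_ge0 => u _;
      rewrite lee_fin mulr_ge0 ?powR_ge0 ?expR_ge0.
  - apply/measurable_restrict => //; apply: measurable_funTS.
    by apply/measurable_EFinP; exact: measurable_powR_expRN.
  - apply/measurable_EFinP; apply: measurable_funM => //.
    exact: measurable_exponential_pdf.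
  move=> t _; rewrite patchE mem_setE in_itv/= andbT; case: ifPn => [t0|_];
    last first.
    by rewrite -EFinM lee_fin !mulr_ge0 ?powR_ge0 ?exponential_pdf_ge0// ltW.
  rewrite exponential_pdfE ?(ltW t0)// -EFinM lee_fin.
  have -> : 2 * (2 * y) `^ y * (2^-1 * expR (- 2^-1 * t)) =
      (2 * y) `^ y * expR (t / 2) * expR (- t).
    rewrite -[RHS]mulrA -expRD mulrACA mulfV// mul1r; congr (_ * expR _).
    by field.
  by rewrite ler_wpM2r ?expR_ge0// powR_le_expR// ltW.
move=> x0; have := gt1 _ x0; rewrite eGammaS//.
have := eGamma_ge0 x; case: (eGamma x) => [r _ _|_|]//; first exact: ltry.
by rewrite gt0_muley ?lte_fin.
Qed.

Lemma eGamma_fin_num (x : R) : 0 < x -> eGamma x \is a fin_num.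
Proof. by move=> x0; rewrite ge0_fin_numE ?eGamma_ge0 ?eGamma_lty. Qed.

Lemma eGammaE (x : R) : 0 < x -> eGamma x = (Gamma x)%:E.
Proof. by move=> x0; rewrite /Gamma /Rintegral fineK// eGamma_fin_num. Qed.

Lemma GammaS (x : R) : 0 < x -> Gamma (x + 1) = x * Gamma x.
Proof.
move=> x0; apply: EFin_inj; rewrite EFinM -!eGammaE// ?eGammaS//.
by rewrite addr_gt0.
Qed.

(** At [y + 1] the integrand is at least [expR (- 2)] on [1, 2]; the functional equation brings
    positivity down to [x]. *)
Lemma Gamma_gt0 (x : R) : 0 < x -> 0 < Gamma x.
Proof.
have gt1 (y : R) : 0 < y -> 0 < Gamma (y + 1).
  move=> y0; rewrite -lte_fin -eGammaE ?addr_gt0// /eGamma addrK.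
  apply: (@lt_le_trans _ _ (\int[leb]_(t in `[1%R, 2%R]) (expR (- 2))%:E)%E).
    rewrite integral_cst//= lebesgue_measure_itv/= lte_fin ltr1n.
    by rewrite -EFinB -EFinM lte_fin mulr_gt0 ?expR_gt0// subr_gt0 ltr1n.
  apply: (@le_trans _ _ (\int[leb]_(t in `[1%R, 2%R]) (t `^ y * expR (-
    t))%:E)%E).
    apply: ge0_le_integral => //.
    - apply: measurable_funTS; apply/measurable_EFinP.
      exact: measurable_powR_expRN.
    move=> t; rewrite /= in_itv/= => /andP[t1 t2].
    rewrite lee_fin -[leLHS]mul1r ler_pM ?expR_ge0//.
      by rewrite -[leLHS](powRr0 t) ler_powR// ltW.
    by rewrite ler_expR lerN2.
  apply: ge0_subset_integral => //.
  - apply: measurable_funTS; apply/measurable_EFinP.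
    exact: measurable_powR_expRN.
  - by move=> t _; rewrite lee_fin mulr_ge0 ?powR_ge0 ?expR_ge0.
  - move=> t; rewrite /= !in_itv/= andbT => /andP[+ _]; exact: lt_le_trans.
by move=> x0; have := gt1 _ x0; rewrite GammaS// pmulr_rgt0.
Qed.
End one_dim.

(** * Integration against a measure given by a density *)

Section density.
Local Open Scope ereal_scope.
Context d (T : measurableType d) (R : realType).
Variables (mu nu : {measure set T -> \bar R}) (w : T -> R).
Hypotheses (mw : measurable_fun setT w) (w0 : forall x, (0 <= w x)%R).
Hypothesis nuE : forall A, measurable A -> nu A = \int[mu]_(x in A) (w x)%:E.

Import HBNNSimple.

Let integral_density_nnsfun (f : {nnsfun T >-> R}) :
  \int[nu]_x (f x)%:E = \int[mu]_x ((f x)%:E * (w x)%:E).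
Proof.
under [LHS]eq_integral do rewrite fimfunE -fsumEFin//.
rewrite [LHS]ge0_integral_fsum//; last 2 first.
  - by move=> r; exact/measurable_EFinP/measurableT_comp.
  - by move=> n x _; rewrite EFinM nnfun_muleindic_ge0.
under [RHS]eq_integral.
  move=> x xD; rewrite fimfunE -fsumEFin// ge0_mule_fsuml; last first.
    by move=> r; rewrite EFinM nnfun_muleindic_ge0.
  over.
rewrite [RHS]ge0_integral_fsum//; last 2 first.
  - move=> r; apply: emeasurable_funM => //.
    by apply/measurable_EFinP; exact/measurableT_comp.
    exact/measurable_EFinP.
  - move=> n x _; apply: mule_ge0; last by rewrite lee_fin.
    by rewrite EFinM nnfun_muleindic_ge0.
apply: eq_fsbigr => r rf; rewrite integralZl_indic_nnsfun//=.
rewrite integral_indic// setIT nuE//.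
have r0 : (0 <= r)%R by move: rf; rewrite inE => -[x _ <-].
rewrite -ge0_integralZl//; last 2 first.
- by apply: measurable_funTS; exact/measurable_EFinP.
- by move=> x _; rewrite lee_fin.
rewrite integral_mkcond; apply: eq_integral => x _.
rewrite patchE indicE; case: ifPn => _; rewrite ?mulr1// mulr0 mul0e//.
Qed.

(** Simple functions, then monotone convergence. It turns moments under [pgauss p] into Lebesgue
    integrals. *)
Lemma ge0_integral_density (f : T -> \bar R) :
  measurable_fun setT f -> (forall x, 0 <= f x) ->
  \int[nu]_x f x = \int[mu]_x (f x * (w x)%:E).
Proof.
move=> mf f0.
pose h := nnsfun_approx measurableT mf.
transitivity (limn (fun n => \int[nu]_x (h n x)%:E)).
  rewrite -monotone_convergence//=.
  - by apply: eq_integral => x _; apply/esym/cvg_lim => //;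
      exact: cvg_nnsfun_approx.
  - by move=> n; exact/measurable_EFinP.
  - by move=> n x _; rewrite lee_fin.
  - by move=> x _ m n mn; rewrite lee_fin; exact/lefP/nd_nnsfun_approx.
under eq_fun do rewrite integral_density_nnsfun.
rewrite -monotone_convergence//=.
- apply: eq_integral => x _; apply/cvg_lim => //.
  by apply: cvgeZr => //; exact: cvg_nnsfun_approx.
- move=> n; apply: emeasurable_funM; first exact/measurable_EFinP.
  exact/measurable_EFinP.
- by move=> n x _; rewrite mule_ge0// lee_fin.
- move=> x _ m n mn; rewrite lee_wpmul2r ?lee_fin//.
  exact/lefP/nd_nnsfun_approx.
Qed.

End density.

(** * Absolute moments of the p-Gaussian *)

Section moments.
Context {R : realType}.
Local Notation leb := (@lebesgue_measure R).

Lemma ge0_integral_even (f : R -> \bar R) :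
  measurable_fun [set: measurableTypeR R] f -> (forall x, 0 <= f x)%E ->
  (forall x, f (- x) = f x) ->
  (\int[leb]_x f x = 2%:E * \int[leb]_(x in `]0%R, +oo[) f x)%E.
Proof.
move=> mf f0 fN.
rewrite (integral_itv_obnd_cbnd (measurable_funTS mf)).
rewrite -(setUv (`[0%R, +oo[ : set (measurableTypeR R))) ge0_integral_setU//=;
  last 3 first.
- exact: measurableC.
- by rewrite setUv.
- exact/disj_setPCl.
rewrite mule_natl mule2n; congr (_ + _)%E.
rewrite ge0_integration_by_substitution0// setCitvr.
rewrite integral_itv_bndo_bndc; last exact: measurable_funTS.
by apply: eq_integral => x _; rewrite fN.
Qed.

(** Closed form of [M_p(a)], with the Gamma arguments shifted by 1 as the layer cake produces them.
    The second branch is the moment of the uniform distribution on [-1, 1]. *)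
Definition pgauss_abs_moment (p : \bar R) (a : R) : R :=
  if p is r%:E then
    r `^ (a / r) / (a + 1) * (Gamma ((a + 1) / r + 1) / Gamma (r^-1 + 1))
  else (a + 1)^-1.

Lemma integral_powR_pgauss_pdf (p : \bar R) (a : R) : (0 < p)%E -> 0 <= a ->
  (\int[leb]_x (`|x| `^ a * pgauss_pdf p x)%:E = (pgauss_abs_moment p a)%:E)%E.
Proof.
move=> p0 a0.
have mf : measurable_fun [set: R] (fun x : R => `|x| `^ a * pgauss_pdf p x).
  apply: measurable_funM; last exact: measurable_pgauss_pdf.
  by apply: (measurableT_comp (measurable_powR _)); exact: normr_measurable.
have a10 : 0 < a + 1 by rewrite ltr_wpDl.
rewrite ge0_integral_even; first last.
- move=> x; rewrite normrN; congr (_ * _)%:E.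
  case: p p0 {mf} => [r _|_|//]; rewrite /pgauss_pdf ?normrN; first by [].
  rewrite !indicE; congr (_ * (_ %:R)).
  by rewrite !mem_setE !in_itv/= lerN2 [- x <= 1]lerNl andbC.
- by move=> x; rewrite lee_fin mulr_ge0 ?powR_ge0// -lee_fin pgauss_pdf_ge0.
- exact/measurable_EFinP.
case: p p0 mf => [r| |]//= r0 mf.
  rewrite lte_fin in r0.
  pose c := (2 * r `^ r^-1 * Gamma (r^-1 + 1))^-1.
  have c0 : 0 <= c.
    by rewrite invr_ge0 !mulr_ge0 ?powR_ge0 ?Gamma_ge0.
  rewrite (_ : (\int[leb]_(x in _) _)%E =
    (c%:E * \int[leb]_(x in `]0%R, +oo[)
      (x `^ (a + 1 - 1) * expR (- (`|x| `^ r / r)))%:E)%E); last first.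
    rewrite -ge0_integralZl//.
    - apply: eq_integral => x; rewrite inE/= in_itv/= andbT => x0.
      rewrite /pgauss_pdf -EFinM; congr EFin.
      by rewrite addrK (gtr0_norm x0) mulrCA.
    - apply: measurable_funTS; apply/measurable_EFinP.
      apply: measurable_funM; first exact: measurable_powR.
      apply: measurableT_comp => //; apply: measurableT_comp => //.
      apply: measurable_funM => //.
      by apply: (measurableT_comp (measurable_powR _)); exact: normr_measurable.
    - by move=> t _; rewrite lee_fin mulr_ge0 ?powR_ge0 ?expR_ge0.
  have ar0 : 0 < (a + 1) / r by rewrite divr_gt0.
  rewrite integral_powR_expRN// eGammaE ?addr_gt0// -!EFinM; congr EFin.
  have -> : r `^ ((a + 1) / r) = r `^ (a / r) * r `^ r^-1.
    by rewrite mulrDl mul1r powRD// (gt_eqF r0) implybT.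
  rewrite /c.
  field; rewrite (gt_eqF a10) gt_eqF ?Gamma_gt0 ?addr_gt0 ?invr_gt0//=.
  by rewrite gt_eqF// powR_gt0.
rewrite (_ : (\int[leb]_(x in _) _)%E =
    (2^-1%:E * \int[leb]_(x in `]0%R, 1%R]) (x `^ (a + 1 - 1))%:E)%E);
      last first.
  rewrite -ge0_integralZl//.
  - rewrite [LHS]integral_mkcond [RHS]integral_mkcond.
    apply: eq_integral => x _; rewrite !patchE !mem_setE !in_itv/= andbT.
    case: ifPn => //= x0.
    rewrite indicE mem_setE in_itv/= (gtr0_norm x0) addrK.
    rewrite (le_trans _ (ltW x0)) ?lerN10//=.
    by case: ifPn => _; rewrite ?mulr0// mulr1 -EFinM mulrC.
  - by apply: measurable_funTS; apply/measurable_EFinP; exact: measurable_powR.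
  - by move=> t _; rewrite lee_fin powR_ge0.
rewrite integral_itvoc_powR// powR1 mul1r -!EFinM; congr EFin.
by rewrite mulrA mulfV// mul1r.
Qed.

Lemma integral_pgauss_pdf (p : \bar R) : (0 < p)%E ->
  (\int[leb]_x (pgauss_pdf p x)%:E = 1)%E.
Proof.
move=> p0; have := integral_powR_pgauss_pdf p0 (lexx 0).
under eq_integral do rewrite powRr0 mul1r.
move=> ->; congr EFin; case: p p0 => [r| |]//=; rewrite add0r ?invr1//
  lte_fin => r0.
rewrite mul0r powRr0 !mul1r mulfV// gt_eqF// Gamma_gt0//.
by rewrite addr_gt0// invr_gt0.
Qed.

Lemma pgauss_momentE (p : \bar R) (q : R) : (0 < p)%E -> 0 <= q ->
  pgauss_moment p q = pgauss_abs_moment p q.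
Proof.
move=> p0 q0; rewrite /pgauss_moment /Rintegral.
rewrite (@ge0_integral_density _ _ _ leb (pgauss p) (pgauss_pdf p))//.
- by under eq_integral do rewrite -EFinM; rewrite integral_powR_pgauss_pdf.
- exact: measurable_pgauss_pdf.
- by move=> x; rewrite -lee_fin pgauss_pdf_ge0.
- apply/measurable_EFinP.
  by apply: (measurableT_comp (measurable_powR _)); exact: normr_measurable.
Qed.

Lemma pgauss_abs_moment_gt0 (p : \bar R) (q : R) : (0 < p)%E -> 0 <= q ->
  0 < pgauss_abs_moment p q.
Proof.
case: p => [r| |]//= p0 q0; last by rewrite invr_gt0 ltr_wpDl.
rewrite lte_fin in p0.
have q10 : 0 < q + 1 by rewrite ltr_wpDl.
rewrite mulr_gt0// divr_gt0 ?powR_gt0 ?Gamma_gt0// addr_gt0 ?divr_gt0//.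
by rewrite invr_gt0.
Qed.

(* The reason for the factor 1/p in the exponent of the density. *)
Lemma pgauss_abs_moment1 (r : R) : 0 < r -> pgauss_abs_moment r%:E r = 1.
Proof.
move=> r0 /=; rewrite divff ?gt_eqF// powRr1 ?ltW// mulrDl divff ?gt_eqF//
  mul1r.
have ? : 0 < r^-1 + 1 by rewrite addr_gt0 ?invr_gt0.
have ? : 0 < r + 1 by rewrite addr_gt0.
rewrite [1 + r^-1]addrC GammaS//; field.
by rewrite !gt_eqF ?Gamma_gt0.
Qed.
End moments.

(** * Integration over tuples and Chebyshev's inequality *)

Section vol_integral.
Context {R : realType}.
Local Notation leb := (@lebesgue_measure R).

Lemma integral_vol_cons n (f : n.+1.-tuple R -> \bar R) :
  measurable_fun setT f -> (forall x, 0 <= f x)%E ->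
  (\int[@vol R n.+1]_x f x = \int[leb]_x \int[@vol R n]_y f (tcons (x, y)))%E.
Proof.
move=> mf f0; have mt := @measurable_tcons R n.
rewrite [LHS](@ge0_integral_pushforward _ _ _ _ R _ mt (leb \x @vol R n)%E)//.
rewrite preimage_setT.
apply: (@fubini_tonelli1 _ _ _ _ _ leb (@vol R n) (f \o @tcons R n)).
  exact: measurableT_comp.
by move=> x; exact: f0.
Qed.

Lemma measurable_integral_vol_cons n (f : n.+1.-tuple R -> \bar R) :
  measurable_fun setT f -> (forall x, 0 <= f x)%E ->
  measurable_fun [set: measurableTypeR R]
    (fun x => \int[@vol R n]_y f (tcons (x, y)))%E.
Proof.
move=> mf f0.
apply: (@measurable_fun_fubini_tonelli_F _ _ _ _ _ (@vol R n) (f \o @tcons R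
  n)).
  by apply: measurableT_comp => //; exact: measurable_tcons.
by move=> x; exact: f0.
Qed.

(** Uniqueness of Lebesgue measure: [s] times its image under [x -> s x] gives half-open intervals
    their length. This reaches every nonnegative measurable [f]. *)
Lemma ge0_integral_lebesgue_scale (s : R) (f : R -> \bar R) : 0 < s ->
  measurable_fun [set: measurableTypeR R] f -> (forall x, 0 <= f x)%E ->
  (s%:E * \int[leb]_x f (s * x)%R = \int[leb]_x f x)%E.
Proof.
move=> s0 mf f0.
pose phi : measurableTypeR R -> measurableTypeR R := fun x => s * x.
have mphi : measurable_fun setT phi by exact: mulrl_measurable.
have [nu nuE] : exists nu : {measure set (measurableTypeR R) -> \bar R},
    nu = pushforward leb phi :> (set _ -> \bar R).
  pose nu0 : {measure set (measurableTypeR R) -> \bar R} := pushforward leb phi.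
  by exists (nu0 mphi).
rewrite [RHS](@eq_measure_integral _ _ _ _ (mscale (NngNum (ltW s0)) nu));
    last first.
  move=> A mA _; apply: lebesgue_measure_unique => // _ [[a b] _ <-].
  rewrite [RHS](_ : _ = (s%:E * pushforward leb phi [set` `]a, b]])%E);
    last first.
    by rewrite -nuE.
  rewrite /pushforward/=.
  have -> : phi @^-1` [set` `]a, b]] = `]a / s, b / s]%classic.
    apply/seteqP; split => x; rewrite /phi/= !in_itv/= => /andP[ax xb].
      by rewrite ltr_pdivrMr// ler_pdivlMr// mulrC ax.
    by rewrite mulrC -ltr_pdivrMr// ax -ler_pdivlMr.
  rewrite !lebesgue_measure_itv/= !lte_fin ltr_pM2r ?invr_gt0//.
  case: ifPn => _; last by rewrite mule0.
  by rewrite -!EFinB -EFinM; congr EFin; field; exact: lt0r_neq0.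
rewrite ge0_integral_mscale//= nuE; congr (_ * _)%E.
by rewrite [RHS](@ge0_integral_pushforward _ _ _ _ R _ mphi leb)//.
Qed.

(** One factor per coordinate: constant factors give dilations, and the inverse semi-axes carry an
    ellipsoid to a ball. *)
Definition scale_tuple n (s : 'I_n -> R) (x : n.-tuple R) : n.-tuple R :=
  [tuple s i * tnth x i | i < n].

Lemma measurable_scale_tuple n (s : 'I_n -> R) :
  measurable_fun setT (scale_tuple s).
Proof.
apply/measurable_fun_tnthP => i.
rewrite (_ : _ \o _ = fun x : n.-tuple R => s i * tnth x i); last first.
  by apply/funext => x /=; rewrite tnth_mktuple.
apply: measurable_funM => //; exact: measurable_tnth.
Qed.

Lemma integral_vol_scale n (s : 'I_n -> R) (f : n.-tuple R -> \bar R) :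
  (forall i, 0 < s i) -> measurable_fun setT f -> (forall x, 0 <= f x)%E ->
  ((\prod_(i < n) s i)%:E * \int[@vol R n]_x f (scale_tuple s x) =
   \int[@vol R n]_x f x)%E.
Proof.
elim: n s f => [|n IH] s f s0 mf f0.
  rewrite big_ord0 mul1e; apply: eq_integral => x _; congr f.
  by apply: eq_from_tnth => -[].
rewrite [RHS]integral_vol_cons// integral_vol_cons//; last first.
  by apply: measurableT_comp => //; exact: measurable_scale_tuple.
have mfs : measurable_fun setT (f \o scale_tuple s).
  by apply: measurableT_comp => //; exact: measurable_scale_tuple.
pose s' (i : 'I_n) := s (lift ord0 i).
have scons x y : scale_tuple s (tcons (x, y)) =
    tcons (s ord0 * x, scale_tuple s' y).
  apply: eq_from_tnth => i; rewrite tnth_mktuple.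
  by case: (unliftP ord0 i) => [j|] ->; rewrite ?tnthS ?tnth0// tnth_mktuple.
have fc0 (x : R) y : (0 <= f (tcons (x, y)))%E by [].
have mfc (x : R) : measurable_fun setT (fun y => f (tcons (x, y))).
  apply: measurableT_comp => //.
  apply: (measurableT_comp (@measurable_tcons R n)).
  exact: measurable_fun_pair.
pose g (x : R) : \bar R := (\int[@vol R n]_y f (tcons (x, y)))%E.
have mg : measurable_fun [set: measurableTypeR R] g.
  exact: measurable_integral_vol_cons.
have g0 x : (0 <= g x)%E by exact: integral_ge0.
rewrite -(ge0_integral_lebesgue_scale (s0 ord0) mg g0) big_ord_recl EFinM
  -muleA.
congr (_ * _)%E; rewrite -ge0_integralZl//; last 3 first.
  - by apply: (measurable_integral_vol_cons mfs) => x; exact: f0.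
  - by move=> x _; exact: integral_ge0.
  - by rewrite lee_fin prodr_ge0// => i _; exact: ltW.
apply: eq_integral => x _.
under eq_integral do rewrite scons.
exact: IH.
Qed.

Lemma vol_scale n (s : 'I_n -> R) (A : set (n.-tuple R)) :
  (forall i, 0 < s i) -> measurable A ->
  ((\prod_(i < n) s i)%:E * vol (scale_tuple s @^-1` A) = vol A)%E.
Proof.
move=> s0 mA.
have mis : measurable_fun setT (fun x : n.-tuple R => (\1_A x : R)%:E).
  by apply/measurable_EFinP; exact: measurable_indic.
have is0 (x : n.-tuple R) : (0 <= (\1_A x : R)%:E)%E by rewrite lee_fin.
have msA : measurable (scale_tuple s @^-1` A).
  by rewrite -[X in measurable X]setTI; exact: measurable_scale_tuple.
have := integral_vol_scale s0 mis is0.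
rewrite [X in _ = X -> _](_ : _ = vol A); last by rewrite integral_indic//
  setIT.
move=> <-; congr (_ * _)%E.
by rewrite -[_ @^-1` _]setIT -(integral_indic (@vol R n) measurableT msA).
Qed.

(* The expectation of h when the coordinates are independent of density phi. It
   is only used for h >= 0 and is \bar R-valued, so that no integrability has to
   be checked. *)
Definition tuple_mean (phi : R -> R) n (h : n.-tuple R -> R) : \bar R :=
  (\int[@vol R n]_x ((\prod_(i < n) phi (tnth x i)) * h x)%:E)%E.

Section tuple_mean.
Variable phi : R -> R.
Hypotheses (mphi : measurable_fun [set: R] phi) (phi0 : forall x, 0 <= phi x).
Hypothesis phi1 : (\int[leb]_x (phi x)%:E = 1)%E.
Local Notation E := (tuple_mean phi).

Lemma measurable_prod_density n :
  measurable_fun setT (fun x : n.-tuple R => \prod_(i < n) phi (tnth x i)).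
Proof.
apply: measurable_prod => i _; apply: measurableT_comp => //.
exact: measurable_tnth.
Qed.

Lemma measurable_density_mul n (h : n.-tuple R -> R) : measurable_fun setT h ->
  measurable_fun setT (fun x => ((\prod_(i < n) phi (tnth x i)) * h x)%:E).
Proof.
move=> mh; apply/measurable_EFinP; apply: measurable_funM => //.
exact: measurable_prod_density.
Qed.

Lemma density_mul_ge0 n (h : n.-tuple R -> R) : (forall x, 0 <= h x) ->
  forall x, (0 <= ((\prod_(i < n) phi (tnth x i)) * h x)%:E)%E.
Proof. by move=> h0 x; rewrite lee_fin mulr_ge0// prodr_ge0. Qed.

Lemma tuple_mean_ge0 n (h : n.-tuple R -> R) : (forall x, 0 <= h x) ->
  (0 <= E h)%E.
Proof. by move=> h0; apply: integral_ge0 => x _; exact: density_mul_ge0. Qed.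

Lemma tuple_mean_le n (f g : n.-tuple R -> R) :
  measurable_fun setT f -> measurable_fun setT g ->
  (forall x, 0 <= f x) -> (forall x, f x <= g x) -> (E f <= E g)%E.
Proof.
move=> mf mg f0 fg; apply: ge0_le_integral => //.
- by move=> x _; exact: density_mul_ge0.
- exact: measurable_density_mul.
- exact: measurable_density_mul.
- by move=> x _; rewrite lee_fin ler_wpM2l// prodr_ge0.
Qed.

Lemma tuple_meanD n (f g : n.-tuple R -> R) :
  measurable_fun setT f -> measurable_fun setT g ->
  (forall x, 0 <= f x) -> (forall x, 0 <= g x) ->
  (E (fun x => f x + g x)%R = E f + E g)%E.
Proof.
move=> mf mg f0 g0; rewrite /tuple_mean -ge0_integralD//.
- by apply: eq_integral => x _; rewrite mulrDr.
- by move=> x _; exact: density_mul_ge0.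
- exact: measurable_density_mul.
- by move=> x _; exact: density_mul_ge0.
- exact: measurable_density_mul.
Qed.

Lemma tuple_meanZ n (k : R) (f : n.-tuple R -> R) :
  measurable_fun setT f -> (forall x, 0 <= f x) -> 0 <= k ->
  (E (fun x => k * f x)%R = k%:E * E f)%E.
Proof.
move=> mf f0 k0; rewrite /tuple_mean -ge0_integralZl//.
- by apply: eq_integral => x _; rewrite mulrCA.
- exact: measurable_density_mul.
- by move=> x _; exact: density_mul_ge0.
Qed.

Lemma tuple_mean_cons n (h : n.+1.-tuple R -> R) :
  measurable_fun setT h -> (forall x, 0 <= h x) ->
  (E h = \int[leb]_x ((phi x)%:E * E (fun y => h (tcons (x, y)))))%E.
Proof.
move=> mh h0; rewrite /tuple_mean integral_vol_cons//; last 2 first.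
- exact: measurable_density_mul.
- exact: density_mul_ge0.
apply: eq_integral => x _; rewrite -ge0_integralZl//; last 3 first.
- apply: measurable_density_mul; apply: measurableT_comp => //.
  apply: (measurableT_comp (@measurable_tcons R n)).
  exact: measurable_fun_pair.
- by move=> y _; rewrite lee_fin mulr_ge0// prodr_ge0.
- by rewrite lee_fin.
apply: eq_integral => y _; rewrite -EFinM big_ord_recl tnth0 mulrA;
  congr (_ * _ * _)%:E.
by apply: eq_bigr => i _; rewrite tnthS.
Qed.

Section weighted_sum.
Variables (g : R -> R) (m1 m2 : R).
Hypotheses (mg : measurable_fun [set: R] g) (g0 : forall x, 0 <= g x).
Hypothesis gm1 : (\int[leb]_x (g x * phi x)%:E = m1%:E)%E.
Hypothesis gm2 : (\int[leb]_x (g x ^+ 2 * phi x)%:E = m2%:E)%E.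

Lemma first_moment_ge0 : 0 <= m1.
Proof.
by rewrite -lee_fin -gm1; apply: integral_ge0 => x _; rewrite lee_fin mulr_ge0.
Qed.

(** The one-coordinate step of both moment inductions: once the other coordinates are integrated
    out, what remains is a polynomial of degree at most 2 in [g x]. *)
Lemma integral_quadratic (a b c : R) : 0 <= a -> 0 <= b -> 0 <= c ->
  (\int[leb]_x ((phi x)%:E * (a * g x ^+ 2 + b * g x + c)%:E) =
   (a * m2 + b * m1 + c)%:E)%E.
Proof.
move=> a0 b0 c0.
have mg2 : measurable_fun [set: R] (fun x => g x ^+ 2 * phi x).
  by apply: measurable_funM => //; exact: measurable_funX.
have mg1 : measurable_fun [set: R] (fun x => g x * phi x).
  exact: measurable_funM.
transitivity (\int[leb]_x (a%:E * (g x ^+ 2 * phi x)%:E +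
    (b%:E * (g x * phi x)%:E + c%:E * (phi x)%:E)))%E.
  by apply: eq_integral => x _; rewrite -!EFinM -!EFinD; congr EFin; ring.
have pos2 x : (0 <= (g x ^+ 2 * phi x)%:E)%E by rewrite lee_fin mulr_ge0//
  sqr_ge0.
have pos1 x : (0 <= (g x * phi x)%:E)%E by rewrite lee_fin mulr_ge0.
have mgE2 : measurable_fun [set: measurableTypeR R] (fun x =>
  (g x ^+ 2 * phi x)%:E).
  exact/measurable_EFinP.
have mgE1 : measurable_fun [set: measurableTypeR R] (fun x => (g x * phi x)%:E).
  exact/measurable_EFinP.
have mgE0 : measurable_fun [set: measurableTypeR R] (fun x => (phi x)%:E).
  exact/measurable_EFinP.
have pos0 x : (0 <= (phi x)%:E)%E by rewrite lee_fin.
rewrite ge0_integralD//.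
- rewrite ge0_integralD//.
  + rewrite !ge0_integralZl// gm1 gm2 phi1 -!EFinM -!EFinD; congr EFin; ring.
  + by move=> x _; rewrite mule_ge0// lee_fin.
  + exact: measurable_funeM.
  + by move=> x _; rewrite mule_ge0// lee_fin.
  + exact: measurable_funeM.
- by move=> x _; rewrite mule_ge0// lee_fin.
- exact: measurable_funeM.
- by move=> x _; rewrite adde_ge0// mule_ge0// lee_fin.
- by apply: emeasurable_funD; exact: measurable_funeM.
Qed.

Definition weighted_sum n (w : 'I_n -> R) (x : n.-tuple R) : R :=
  \sum_(i < n) w i * g (tnth x i).

Lemma measurable_weighted_sum n (w : 'I_n -> R) :
  measurable_fun setT (weighted_sum w).
Proof.
apply: measurable_sum => i; apply: measurable_funM => //.
by apply: measurableT_comp => //; exact: measurable_tnth.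
Qed.

Lemma weighted_sum_ge0 n (w : 'I_n -> R) x : (forall i, 0 <= w i) ->
  0 <= weighted_sum w x.
Proof. by move=> w0; apply: sumr_ge0 => i _; rewrite mulr_ge0. Qed.

Lemma weighted_sum_cons n (w : 'I_n.+1 -> R) x y :
  weighted_sum w (tcons (x, y)) =
  w ord0 * g x + weighted_sum (fun i => w (lift ord0 i)) y.
Proof.
rewrite /weighted_sum big_ord_recl tnth0; congr (_ + _).
by apply: eq_bigr => i _; rewrite tnthS.
Qed.

Lemma tuple_mean_cst n (c : R) : 0 <= c -> E (fun _ : n.-tuple R => c) = c%:E.
Proof.
move=> c0; elim: n => [|n IH].
  rewrite /tuple_mean/= integral_dirac//=; last first.
    exact: (@measurable_density_mul 0 (fun=> c)).
  by rewrite diracE mem_set// mul1e big_ord0 mul1r.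
rewrite tuple_mean_cons//.
under eq_integral do rewrite IH.
rewrite -[RHS]mul1e -phi1 ge0_integralZr//; last by move=> x _; rewrite lee_fin.
exact/measurable_EFinP.
Qed.

Lemma tuple_mean_weighted_sum n (w : 'I_n -> R) : (forall i, 0 <= w i) ->
  E (weighted_sum w) = (m1 * \sum_(i < n) w i)%:E.
Proof.
elim: n w => [|n IH] w w0.
  rewrite big_ord0 mulr0 -(@tuple_mean_cst 0 0)//; congr (E _).
  by apply/funext => x; rewrite /weighted_sum big_ord0.
pose w' i := w (lift ord0 i).
have sw'0 : 0 <= m1 * \sum_(i < n) w' i.
  by rewrite mulr_ge0 ?first_moment_ge0// sumr_ge0// => i _; exact: w0.
rewrite tuple_mean_cons//; last 2 first.
- exact: measurable_weighted_sum.
- by move=> x; exact: weighted_sum_ge0.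
(* The null coefficient of [m2] brings the linear case under [integral_quadratic]. *)
rewrite (_ : (m1 * _) = 0 * m2 + w ord0 * m1 + m1 * \sum_(i < n) w' i);
  last first.
  by rewrite big_ord_recl; ring.
rewrite -integral_quadratic//.
apply: eq_integral => x _; congr (_ * _)%E.
under [X in E X]eq_fun do rewrite weighted_sum_cons.
rewrite (@tuple_meanD _ (fun=> w ord0 * g x) (weighted_sum w'))//.
- rewrite tuple_mean_cst ?mulr_ge0// IH; last by move=> i; exact: w0.
  by rewrite -EFinD mul0r add0r.
- exact: measurable_weighted_sum.
- by move=> _; rewrite mulr_ge0.
- by move=> y; apply: weighted_sum_ge0 => i; exact: w0.
Qed.

(** Additivity of the variance under independence, written as a second moment. The square is
    expanded around the first coordinate, and the cross term is a first moment of the remaining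
    sum. *)
Lemma tuple_mean_weighted_sum_sq n (w : 'I_n -> R) : (forall i, 0 <= w i) ->
  E (fun x => weighted_sum w x ^+ 2) =
  ((m1 * \sum_(i < n) w i) ^+ 2 + (m2 - m1 ^+ 2) * \sum_(i < n) w i ^+ 2)%:E.
Proof.
elim: n w => [|n IH] w w0.
  rewrite !big_ord0 !mulr0 expr0n/= addr0 -(@tuple_mean_cst 0 0)//; congr (E _).
  by apply/funext => x; rewrite /weighted_sum big_ord0 expr0n.
pose w' i := w (lift ord0 i); have w'0 i : 0 <= w' i by exact: w0.
set q := (m1 * \sum_(i < n) w' i) ^+ 2 + (m2 - m1 ^+ 2) * \sum_(i < n) w' i ^+
  2.
have mS := measurable_weighted_sum w'.
have S0 x : 0 <= weighted_sum w' x by exact: weighted_sum_ge0.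
have mS2 : measurable_fun setT (fun x => weighted_sum w' x ^+ 2).
  exact: measurable_funX.
have S20 x : 0 <= weighted_sum w' x ^+ 2 by exact: sqr_ge0.
(* By induction [q] is the mean of a square, which avoids proving [m1 ^+ 2 <= m2]. *)
have q0 : 0 <= q by rewrite -lee_fin /q -IH//; exact: tuple_mean_ge0.
have sw'0 : 0 <= m1 * \sum_(i < n) w' i.
  by rewrite mulr_ge0 ?first_moment_ge0// sumr_ge0.
rewrite tuple_mean_cons//; last 2 first.
- by apply: measurable_funX; exact: measurable_weighted_sum.
- by move=> x; exact: sqr_ge0.
rewrite (_ : _ + _ = w ord0 ^+ 2 * m2 +
    (2 * w ord0 * (m1 * \sum_(i < n) w' i)) * m1 + q); last first.
  by rewrite /q !big_ord_recl; ring.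
rewrite -integral_quadratic ?sqr_ge0 ?(mulr_ge0 (mulr_ge0 _ _) sw'0)//.
apply: eq_integral => x _; congr (_ * _)%E.
have a0 : 0 <= w ord0 * g x by rewrite mulr_ge0.
rewrite (_ : (fun y => _) = (fun y => (w ord0 * g x) ^+ 2 +
    (2 * (w ord0 * g x) * weighted_sum w' y + weighted_sum w' y ^+ 2)));
      last first.
  by apply/funext => y; rewrite weighted_sum_cons -/w'; ring.
rewrite tuple_meanD//; last 3 first.
- apply: measurable_funD => //; exact: measurable_funM.
- by move=> y; exact: sqr_ge0.
- by move=> y; rewrite addr_ge0// !mulr_ge0.
rewrite tuple_meanD//; last 2 first.
- exact: measurable_funM.
- by move=> y; rewrite !mulr_ge0.
rewrite tuple_meanZ// ?mulr_ge0// tuple_mean_cst ?sqr_ge0// IH//.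
rewrite tuple_mean_weighted_sum// -/q -EFinM -!EFinD; congr EFin; ring.
Qed.

(** Chebyshev's inequality, with the variance [m2 - m1 ^+ 2] rounded up to [m2]. *)
Lemma weighted_sum_chebyshev n (w : 'I_n -> R) (e : R) :
  (forall i, 0 <= w i) -> 0 < e ->
  (E \1_[set x | (e <= `|weighted_sum w x - m1 * \sum_(i < n) w i|)%R] <=
   (m2 * (\sum_(i < n) w i ^+ 2) / e ^+ 2)%:E)%E.
Proof.
move=> w0 e0; set M := m1 * _; set A := [set x | _].
have M0 : 0 <= M by rewrite mulr_ge0 ?first_moment_ge0// sumr_ge0.
have M20 : 0 <= 2 * M by rewrite (mulr_ge0 _ M0).
have mS := measurable_weighted_sum w.
have S0 x : 0 <= weighted_sum w x by exact: weighted_sum_ge0.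
have mS2 : measurable_fun setT (fun x => (weighted_sum w x - M) ^+ 2).
  by apply: measurable_funX; exact: measurable_funB.
have mA : measurable A.
  rewrite -[X in measurable X]setTI; apply: measurable_fun_le => //.
  by apply: measurableT_comp => //; exact: measurable_funB.
have var : (E (fun x => (weighted_sum w x - M) ^+ 2)%R <=
    (m2 * \sum_(i < n) w i ^+ 2)%:E)%E.
  (* Additivity of the mean is available for nonnegative functions, so the cross term of the square
     is moved to the left side. *)
  have : E (fun x => (weighted_sum w x - M) ^+ 2 + 2 * M * weighted_sum w x) =
      E (fun x => weighted_sum w x ^+ 2 + M ^+ 2).
    by congr (E _); apply/funext => x; ring.
  rewrite !tuple_meanD//; last 6 first.
  - exact: measurable_funX.
  - by move=> x; exact: sqr_ge0.
  - by move=> x; exact: sqr_ge0.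
  - exact: measurable_funM.
  - by move=> x; exact: sqr_ge0.
  - by move=> x; rewrite (mulr_ge0 M20).
  rewrite tuple_meanZ// tuple_mean_cst ?sqr_ge0//.
  rewrite tuple_mean_weighted_sum_sq// tuple_mean_weighted_sum// -/M.
  rewrite -EFinM -EFinD.
  have := @tuple_mean_ge0 n (fun x => (weighted_sum w x - M) ^+ 2)
    (fun x => sqr_ge0 _).
  case: (E _) => [v| |]//= v0; rewrite -EFinD => -[vE]; rewrite lee_fin.
  rewrite (_ : v = (m2 - m1 ^+ 2) * \sum_(i < n) w i ^+ 2); last first.
    by move: vE; lra.
  by rewrite ler_wpM2r ?sumr_ge0// => [i _|]; rewrite ?sqr_ge0// gerBl sqr_ge0.
have e20 : 0 < e ^+ 2 by rewrite exprn_gt0.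
rewrite EFinM lee_pdivlMr// muleC (le_trans _ var)//.
rewrite -tuple_meanZ ?sqr_ge0//.
apply: tuple_mean_le => //.
- by apply: measurable_funM => //; exact: measurable_indic.
- by move=> x; rewrite mulr_ge0 ?sqr_ge0.
- move=> x; rewrite indicE; case: (boolP (x \in A)) => [|_]; last first.
    by rewrite mulr0 sqr_ge0.
  by rewrite inE mulr1 -[leRHS]real_normK ?num_real// ler_sqr ?nnegrE// ltW.
Qed.

End weighted_sum.
End tuple_mean.
End vol_integral.

(** * Balls and cones *)

Section balls.
Context {R : realType}.
Local Notation leb := (@lebesgue_measure R).
Implicit Types (p : \bar R) (r : R).

Definition abs_pow r (x : R) : R := `|x| `^ r.

Lemma measurable_abs_pow r : measurable_fun [set: R] (abs_pow r).
Proof. by apply: (measurableT_comp (measurable_powR _));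
  exact: normr_measurable. Qed.

Lemma abs_pow_ge0 r x : 0 <= abs_pow r x. Proof. exact: powR_ge0. Qed.

Lemma abs_powM r a x : 0 <= a -> abs_pow r (a * x) = a `^ r * abs_pow r x.
Proof. by move=> a0; rewrite /abs_pow normrM (ger0_norm a0) powRM. Qed.

Definition abs_pow_sum r n (x : n.-tuple R) : R :=
  \sum_(i < n) abs_pow r (tnth x i).

Lemma measurable_abs_pow_sum r n : measurable_fun setT (@abs_pow_sum r n).
Proof.
apply: measurable_sum => i; apply: measurableT_comp.
  exact: measurable_abs_pow.
exact: measurable_tnth.
Qed.

Lemma abs_pow_sum_ge0 r n (x : n.-tuple R) : 0 <= abs_pow_sum r x.
Proof. by apply: sumr_ge0 => i _; exact: abs_pow_ge0. Qed.

Lemma abs_pow_sum_scale r n a (x : n.-tuple R) : 0 <= a ->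
  abs_pow_sum r (scale_tuple (fun=> a) x) = a `^ r * abs_pow_sum r x.
Proof.
move=> a0; rewrite mulr_sumr; apply: eq_bigr => i _.
by rewrite tnth_mktuple abs_powM.
Qed.

Lemma one_powR r : 1 `^ r = 1 :> R.
Proof. by rewrite powR1. Qed.

Lemma pball_finE r n : 0 < r ->
  pball n r%:E = [set x : n.-tuple R | abs_pow_sum r x <= 1].
Proof.
move=> r0; apply/seteqP; split => x; rewrite /pball /pnorm /= -/(abs_pow_sum r
  x) => h.
  rewrite (_ : abs_pow_sum r x = (abs_pow_sum r x `^ r^-1) `^ r).
    by rewrite -(one_powR r) ge0_ler_powR ?nnegrE ?powR_ge0// ltW.
  by rewrite -powRrM mulVf ?gt_eqF// powRr1// abs_pow_sum_ge0.
by rewrite -(one_powR r^-1) ge0_ler_powR ?nnegrE ?abs_pow_sum_ge0 ?invr_ge0//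
  ltW.
Qed.

Lemma pball_pinftyE n :
  pball n +oo%E = [set x : n.-tuple R | forall i, -1 <= tnth x i <= 1].
Proof.
apply/seteqP; split => x; rewrite /pball /pnorm /=.
  by move=> /bigmax_leP[_ h] i; rewrite -ler_norml h.
by move=> h; apply/bigmax_leP; split => // i _; rewrite ler_norml h.
Qed.

Lemma measurable_abs_pow_sum_le r n (u : R) :
  measurable [set x : n.-tuple R | abs_pow_sum r x <= u].
Proof.
rewrite -[X in measurable X]setTI; apply: measurable_fun_le => //.
exact: measurable_abs_pow_sum.
Qed.

Lemma measurable_pball p n : (0 < p)%E -> measurable (pball n p).
Proof.
case: p => [r| |]//; first by move=> r0; rewrite pball_finE//;
  exact: measurable_abs_pow_sum_le.
move=> _; rewrite pball_pinftyE.
rewrite (_ : [set x | _] =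
    \bigcap_(i in [set: 'I_n]) ((@tnth _ R)^~ i @^-1` `[-1, 1])).
  apply: fin_bigcap_measurable => // i _.
  by rewrite -[X in measurable X]setTI; exact: measurable_tnth.
apply/seteqP; split => x /= H i; first by move=> _ /=; rewrite in_itv/=.
by have := H i I; rewrite /= in_itv.
Qed.

Lemma vol_pball_pinfty n : vol (pball n +oo%E) = ((2 : R) ^+ n)%:E.
Proof.
rewrite pball_pinftyE.
have := @vol_box R n [tuple -1 | _ < n] [tuple 1 | _ < n].
rewrite (_ : [set x | _] = [set x : n.-tuple R | forall i, -1 <= tnth x i <=
  1]).
  move=> ->; last by move=> i; rewrite !tnth_mktuple; lra.
  under eq_bigr do rewrite !tnth_mktuple opprK.
  by rewrite prodr_const card_ord.
by apply/seteqP; split => x /= h i; have := h i; rewrite !tnth_mktuple.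
Qed.

(** * Cones under the product measure and in the ball, for finite p *)

Section fin_exponent.
Variable r : R.
Hypothesis r0 : 0 < r.
Local Notation pdf := (pgauss_pdf r%:E).
Local Notation E := (tuple_mean pdf).

Definition pgauss_norm_cst : R := (2 * r `^ r^-1 * Gamma (r^-1 + 1))^-1.
Local Notation c := pgauss_norm_cst.

Lemma pgauss_norm_cst_gt0 : 0 < c.
Proof.
rewrite /pgauss_norm_cst invr_gt0 !mulr_gt0 ?powR_gt0 ?Gamma_gt0//.
by rewrite addr_gt0// invr_gt0.
Qed.

Lemma prod_pgauss_pdf n (x : n.-tuple R) :
  \prod_(i < n) pdf (tnth x i) = c ^+ n * expR (- (abs_pow_sum r x / r)).
Proof.
rewrite /abs_pow_sum/= big_split/= prodr_const card_ord; congr (_ * _).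
by rewrite mulr_suml -sumrN expR_sum.
Qed.

Definition cone n (A : set (n.-tuple R)) :=
  forall a x, 0 < a -> A (scale_tuple (fun=> a) x) <-> A x.

(** Dilation by [u^(1/r)] carries the unit ball to the sublevel set of level [u] and preserves
    [A]. *)
Lemma vol_cone n (A : set (n.-tuple R)) (u : R) : measurable A -> cone A ->
  0 < u ->
  vol (A `&` [set x | abs_pow_sum r x <= u]) =
  ((u `^ (n%:R / r))%:E * vol (A `&` pball n r%:E))%E.
Proof.
move=> mA coneA u0.
have a0 : 0 < u `^ r^-1 by rewrite powR_gt0.
rewrite -(@vol_scale _ _ (fun=> u `^ r^-1))//; last first.
  by apply: measurableI => //; exact: measurable_abs_pow_sum_le.
rewrite prodr_const card_ord -powR_mulrn ?powR_ge0// -powRrM [r^-1 * _]mulrC.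
congr (_ * vol _)%E; rewrite pball_finE//.
have auE : (u `^ r^-1) `^ r = u.
  by rewrite -powRrM mulVf ?gt_eqF// powRr1// ltW.
apply/seteqP; split => x /= [Ax]; rewrite abs_pow_sum_scale ?powR_ge0// auE =>
  xu.
  by split; [apply/coneA; [exact: a0|]|rewrite -(ler_pM2l u0) mulr1].
by split; [exact/coneA|rewrite -[leRHS]mulr1 ler_pM2l].
Qed.

(** By homogeneity every layer contributes the same volume [vol (A & ball)] times a factor depending
    on [u] alone; [K] collects these factors. It stays unevaluated, possibly infinite, because the
    whole space, itself a cone, will identify it. *)
Lemma tuple_mean_cone n : exists2 K : \bar R, (0 <= K)%E &
  forall A : set (n.-tuple R), measurable A -> cone A ->
  E \1_A = (K * vol (A `&` pball n r%:E))%E.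
Proof.
exists (\int[leb]_(u in `]0%R, +oo[)
    ((expR (- u))%:E * (c ^+ n * (r * u) `^ (n%:R / r))%:E))%E.
  apply: integral_ge0 => u _.
  by rewrite mule_ge0// lee_fin ?expR_ge0// mulr_ge0 ?powR_ge0// exprn_ge0//
    ltW// pgauss_norm_cst_gt0.
move=> A mA coneA; have c0 := ltW pgauss_norm_cst_gt0.
have cn0 : 0 <= c ^+ n by rewrite exprn_ge0.
pose g (x : n.-tuple R) := abs_pow_sum r x / r.
pose h (x : n.-tuple R) : \bar R := (c ^+ n * \1_A x)%:E.
have mg : measurable_fun setT g.
  by apply: measurable_funM => //; exact: measurable_abs_pow_sum.
have mh : measurable_fun setT h.
  by apply/measurable_EFinP; apply: measurable_funM => //;
    exact: measurable_indic.
have g0 x : 0 <= g x by rewrite divr_ge0 ?abs_pow_sum_ge0// ltW.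
have h0 x : (0 <= h x)%E by rewrite lee_fin mulr_ge0.
transitivity (\int[@vol R n]_x (h x * (expR (- g x))%:E))%E.
  by apply: eq_integral => x _; rewrite prod_pgauss_pdf -EFinM mulrAC.
rewrite layer_cake// -ge0_integralZr//; first last.
- by move=> u _; rewrite mule_ge0// lee_fin ?expR_ge0// mulr_ge0// powR_ge0.
- apply: measurable_funTS; apply: emeasurable_funM; apply/measurable_EFinP.
    apply: continuous_measurable_fun => x; apply: continuous_comp;
      [exact: opp_continuous|exact: continuous_expR].
  apply: measurable_funM => //; apply: (measurableT_comp (measurable_powR _)).
  exact: mulrl_measurable.
apply: eq_integral => u; rewrite inE/= in_itv/= andbT => u0.
rewrite -muleA; congr (_ * _)%E.
rewrite [X in integral _ X](_ : _ = [set x | abs_pow_sum r x <= r * u]);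
  last first.
  by apply/seteqP; split => x; rewrite /g /= ler_pdivrMr// mulrC.
have mB := @measurable_abs_pow_sum_le r n (r * u).
under eq_integral do rewrite /h EFinM.
rewrite ge0_integralZl//; first last.
- by apply: measurable_funTS; apply/measurable_EFinP; exact: measurable_indic.
rewrite integral_indic// EFinM -[RHS]muleA; congr (_ * _)%E.
by apply: vol_cone => //; rewrite mulr_gt0.
Qed.

Lemma cone_setT n : @cone n setT. Proof. by []. Qed.

(** The whole space has mass 1, so [1 = K * vol (pball n r)]. In the extended nonnegative reals,
    where 0 times infinity is 0, this forces both factors to be finite and positive. *)
Lemma vol_pball_fin n : exists2 v : R, 0 < v & vol (pball n r%:E) = v%:E.
Proof.
have [K K0 KE] := tuple_mean_cone n.
have := KE setT measurableT (@cone_setT n).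
rewrite setTI (_ : \1_setT = fun=> 1); last by apply/funext => x;
  rewrite indicT.
rewrite tuple_mean_cst//; last 3 first.
- exact: measurable_pgauss_pdf.
- by move=> x; rewrite -lee_fin pgauss_pdf_ge0.
- by rewrite integral_pgauss_pdf// lte_fin.
have := @vol_ge0 R n (pball n r%:E).
case: (vol _) => [v| |]// v0; case: K K0 {KE} => [k| |]// k0.
- rewrite -EFinM => -[kv]; exists v => //; rewrite lt_neqAle -lee_fin v0 andbT.
  by apply: contra_eq_neq kv => <-; rewrite mulr0 oner_neq0.
- move: v0; rewrite le_eqVlt => /predU1P[<-|v0]; first by rewrite mule0 =>
    -[] /eqP; rewrite oner_eq0.
  by rewrite gt0_mulye.
- move: k0; rewrite le_eqVlt => /predU1P[<-|k0]; first by rewrite mul0e =>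
    -[] /eqP; rewrite oner_eq0.
  by rewrite gt0_muley.
Qed.

(** The whole space gives [K] as the inverse volume of the ball. *)
Lemma tuple_mean_coneE n (A : set (n.-tuple R)) : measurable A -> cone A ->
  E \1_A = (fine (vol (A `&` pball n r%:E)) / fine (vol (pball n r%:E)))%:E.
Proof.
move=> mA coneA; have [K K0 KE] := tuple_mean_cone n.
have := KE setT measurableT (@cone_setT n).
rewrite setTI (_ : \1_setT = fun=> 1); last by apply/funext => x;
  rewrite indicT.
rewrite tuple_mean_cst//; last 3 first.
- exact: measurable_pgauss_pdf.
- by move=> x; rewrite -lee_fin pgauss_pdf_ge0.
- by rewrite integral_pgauss_pdf// lte_fin.
rewrite KE//; have [v v0 vE] := vol_pball_fin n; rewrite vE/=.
have : (vol (A `&` pball n r%:E) <= vol (pball n r%:E))%E.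
  have mB : measurable (pball n r%:E) by exact: measurable_pball.
  by apply: le_measure; rewrite ?inE//; exact: measurableI.
have := @vol_ge0 R n (A `&` pball n r%:E); rewrite vE.
case: (vol (A `&` _)) => [w| |]// w0 _.
case: K K0 {KE} => [k| |]// k0; last by rewrite gt0_mulye.
rewrite -!EFinM => -[kv] /=; congr EFin.
by rewrite [k](_ : _ = v^-1) 1?mulrC//; apply: (mulIf (lt0r_neq0 v0));
  rewrite -kv mulVf ?gt_eqF.
Qed.

End fin_exponent.

Lemma vol_pball_gt0 p n : (0 < p)%E ->
  exists2 v : R, 0 < v & vol (pball n p) = v%:E.
Proof.
case: p => [r| |]// p0; first exact: vol_pball_fin.
by exists (2 ^+ n); [rewrite exprn_gt0|exact: vol_pball_pinfty].
Qed.

(** * The uniform distribution on the ball *)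

Definition ball_frac p n (A : set (n.-tuple R)) : R :=
  fine (vol (A `&` pball n p)) / fine (vol (pball n p)).

Section ball_frac.
Variables (p : \bar R) (n : nat).
Hypothesis p0 : (0 < p)%E.
Implicit Types A B C : set (n.-tuple R).

Lemma vol_setI_pball_fin_num A : measurable A ->
  vol (A `&` pball n p) \is a fin_num.
Proof.
move=> mA; have mB := @measurable_pball p n p0.
rewrite ge0_fin_numE//; have [v _ vE] := @vol_pball_gt0 p n p0.
apply: (@le_lt_trans _ _ (vol (pball n p))); last by rewrite vE ltry.
by apply: le_measure; rewrite ?inE//; exact: measurableI.
Qed.

Lemma fine_vol_pball_gt0 : 0 < fine (vol (pball n p)).
Proof. by have [v v0 ->] := @vol_pball_gt0 p n p0. Qed.

Lemma ball_frac_ge0 A : 0 <= ball_frac p A.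
Proof. by rewrite divr_ge0 ?fine_ge0. Qed.

(** The inclusion is asked inside the ball alone, so that comparisons of events may use the bound on
    the p-norm; likewise in [ball_fracU]. *)
Lemma ball_frac_le A B : measurable A -> measurable B ->
  A `&` pball n p `<=` B -> ball_frac p A <= ball_frac p B.
Proof.
move=> mA mB AB; have mb := @measurable_pball p n p0.
rewrite ler_pM2r ?invr_gt0 ?fine_vol_pball_gt0//
  fine_le ?vol_setI_pball_fin_num//.
apply: le_measure; rewrite ?inE//; try exact: measurableI.
by move=> x [Ax Bx]; split => //; exact: AB.
Qed.

Lemma ball_fracU A B C : measurable A -> measurable B -> measurable C ->
  A `&` pball n p `<=` B `|` C ->
  ball_frac p A <= ball_frac p B + ball_frac p C.
Proof.
move=> mA mB mC AB; have mb := @measurable_pball p n p0.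
rewrite -mulrDl ler_pM2r ?invr_gt0 ?fine_vol_pball_gt0//.
rewrite -fineD ?vol_setI_pball_fin_num// fine_le ?fin_numD
  ?vol_setI_pball_fin_num//.
apply: (@le_trans _ _ (vol ((B `&` pball n p) `|` (C `&` pball n p)))).
  apply: le_measure; rewrite ?inE//; try exact: measurableI.
    by apply: measurableU; exact: measurableI.
  by move=> x [Ax Bx]; have [] := AB x (conj Ax Bx); [left|right].
by apply: measureU2; exact: measurableI.
Qed.

Lemma ball_fracC A : measurable A -> ball_frac p A = 1 - ball_frac p (~` A).
Proof.
move=> mA; have mb := @measurable_pball p n p0.
have v0 := fine_vol_pball_gt0.
apply/eqP; rewrite -subr_eq0 opprB addrA subr_eq add0r -mulrDl; apply/eqP.
rewrite -fineD ?vol_setI_pball_fin_num//; last exact: measurableC.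
rewrite -measureU//; try (apply: measurableI => //; exact: measurableC).
- by rewrite -setIUl setUv setTI divff// gt_eqF.
- by rewrite setIACA setICr set0I.
Qed.

End ball_frac.

(** * Probabilities under the p-Gaussian product measure *)

Section prob.
Variables (p : \bar R).
Hypothesis p0 : (0 < p)%E.
Local Notation pdf := (pgauss_pdf p).
Local Notation E := (tuple_mean pdf).

Definition prob n (A : set (n.-tuple R)) : R := fine (E \1_A).
Local Notation mpdf := (@measurable_pgauss_pdf R p).

Let pdf0 x : 0 <= pdf x. Proof. by rewrite -lee_fin pgauss_pdf_ge0. Qed.
Let pdf1 := integral_pgauss_pdf p0.

Let mindic n (A : set (n.-tuple R)) : measurable A -> measurable_fun setT (\1_A
  : _ -> R).
Proof. by move=> mA; exact: measurable_indic. Qed.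

Lemma prob_fin n (A : set (n.-tuple R)) : measurable A -> E \1_A = (prob A)%:E.
Proof.
move=> mA; rewrite fineK// ge0_fin_numE; last exact: (tuple_mean_ge0 pdf0 (fun
  x => ler0n _ _)).
apply: (@le_lt_trans _ _ 1%E); last exact: ltry.
rewrite -(@tuple_mean_cst _ _ mpdf pdf0 pdf1 n 1)//.
exact: (tuple_mean_le mpdf pdf0).
Qed.

Lemma prob_ge0 n (A : set (n.-tuple R)) : 0 <= prob A.
Proof. by rewrite fine_ge0//; exact: (tuple_mean_ge0 pdf0 (fun x =>
  ler0n _ _)). Qed.

Lemma probU n (A B C : set (n.-tuple R)) : measurable A -> measurable B ->
  measurable C -> A `<=` B `|` C -> prob A <= prob B + prob C.
Proof.
move=> mA mB mC ABC; rewrite -lee_fin EFinD -!prob_fin//.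
rewrite -(tuple_meanD mpdf pdf0)//; try exact: mindic.
apply: (tuple_mean_le mpdf pdf0) => //; try exact: mindic.
  by apply: measurable_funD; exact: mindic.
move=> x; rewrite !indicE; case: (boolP (x \in A)) => [|_];
  last by rewrite addr_ge0.
rewrite inE => /ABC[Bx|Cx].
  by rewrite (mem_set Bx) lerDl.
by rewrite (mem_set Cx) lerDr.
Qed.

Lemma prob_le n (A B : set (n.-tuple R)) : measurable A -> measurable B ->
  A `<=` B -> prob A <= prob B.
Proof.
move=> mA mB AB; rewrite -lee_fin -!prob_fin//.
apply: (tuple_mean_le mpdf pdf0) => //; try exact: mindic.
move=> x; rewrite !indicE; case: (boolP (x \in A)) => [|_]//.
by rewrite inE => /AB Bx; rewrite (mem_set Bx).
Qed.

Local Notation S q := (weighted_sum (abs_pow q)).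
Local Notation M := (pgauss_abs_moment p).

Lemma prob_weighted_sum q n (w : 'I_n -> R) (e : R) : 0 <= q ->
  (forall i, 0 <= w i) -> 0 < e ->
  prob [set x | e <= `|S q w x - M q * \sum_(i < n) w i|] <=
  M (2 * q) * (\sum_(i < n) w i ^+ 2) / e ^+ 2.
Proof.
move=> q0 w0 e0.
have mS : measurable_fun setT (S q w).
  by apply: measurable_weighted_sum => //; exact: measurable_abs_pow.
rewrite -lee_fin -prob_fin; last first.
  rewrite -[X in measurable X]setTI; apply: measurable_fun_le => //.
  by apply: measurableT_comp => //; exact: measurable_funB.
apply: (weighted_sum_chebyshev mpdf pdf0 pdf1) => //.
- exact: measurable_abs_pow.
- by move=> x; exact: abs_pow_ge0.
- exact: integral_powR_pgauss_pdf.
- rewrite -integral_powR_pgauss_pdf ?mulr_ge0//.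
  by apply: eq_integral => x _; rewrite /abs_pow -powR_mulrn ?powR_ge0//
    -powRrM [q * _]mulrC.
Qed.

End prob.
End balls.

(** * Concentration on the ball *)

Section concentration.
Context {R : realType}.
Implicit Types (p : \bar R) (r : R).
Local Notation S q := (weighted_sum (abs_pow q)).

Lemma measurable_weighted_abs_pow q n (w : 'I_n -> R) : measurable_fun setT (S
  q w).
Proof. by apply: measurable_weighted_sum => //; exact: measurable_abs_pow. Qed.

Lemma measurable_weighted_abs_pow_le q n (w : 'I_n -> R) (u : R) :
  measurable [set x | S q w x <= u].
Proof.
rewrite -[X in measurable X]setTI; apply: measurable_fun_le => //.
exact: measurable_weighted_abs_pow.
Qed.

Lemma measurable_weighted_abs_pow_ge q n (w : 'I_n -> R) (u : R) :
  measurable [set x | u <= S q w x].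
Proof.
rewrite -[X in measurable X]setTI; apply: measurable_fun_le => //.
exact: measurable_weighted_abs_pow.
Qed.

Lemma weighted_abs_pow_scale q n (w : 'I_n -> R) (a : R) x : 0 <= a ->
  S q w (scale_tuple (fun=> a) x) = a `^ q * S q w x.
Proof.
move=> a0; rewrite /weighted_sum mulr_sumr; apply: eq_bigr => i _.
by rewrite tnth_mktuple abs_powM// mulrCA.
Qed.

Lemma weighted_abs_pow_ge0 q n (w : 'I_n -> R) x : (forall i, 0 <= w i) ->
  0 <= S q w x.
Proof. by move=> w0; apply: weighted_sum_ge0 => // y; exact: abs_pow_ge0. Qed.

(** * Weak law of large numbers for weighted sums *)

Section weak_lln.
Variables (p : \bar R) (q : R) (w : forall n, 'I_n -> R).
Hypotheses (p0 : (0 < p)%E) (q0 : 0 <= q).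
Hypothesis w0 : forall n (i : 'I_n), 0 <= w i.
Hypothesis w2 : (\sum_(i < n) w i ^+ 2) @[n --> \oo] --> (0 : R).
Local Notation M := (pgauss_abs_moment p).

Lemma prob_dev_cvg0 (e : R) : 0 < e ->
  prob p [set x | e <= `|S q (@w n) x - M q * \sum_(i < n) w i|] @[n --> \oo]
    --> (0 : R).
Proof.
move=> e0; apply: (@squeeze_cvgr _ _ _ _ (fun=> 0) (fun n =>
    M (2 * q) * (\sum_(i < n) w i ^+ 2) / e ^+ 2)).
- by apply: nearW => n; rewrite prob_ge0//= prob_weighted_sum.
- exact: cvg_cst.
- rewrite -[X in _ --> X](mul0r (e ^+ 2)^-1); apply: cvgMl.
  by rewrite -[X in _ --> X](mulr0 (M (2 * q))); apply: cvgMr.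
Qed.

Lemma measurable_dev n (e : R) :
  measurable [set x | e <= `|S q (@w n) x - M q * \sum_(i < n) w i|].
Proof.
rewrite -[X in measurable X]setTI; apply: measurable_fun_le => //.
apply: measurableT_comp => //; apply: measurable_funB => //.
exact: measurable_weighted_abs_pow.
Qed.

(** An eventual lower bound on the mean takes the place of a limit, so the mean may diverge to
    infinity. *)
Lemma prob_weighted_sum_le_cvg0 (u v : R) : u < v ->
  (\forall n \near \oo, v <= M q * \sum_(i < n) w i) ->
  prob p [set x | S q (@w n) x <= u] @[n --> \oo] --> (0 : R).
Proof.
move=> uv vM; have e0 : 0 < v - u by rewrite subr_gt0.
apply: (@squeeze_cvgr _ _ _ _ (fun=> 0) _ _ _ _ _ (prob_dev_cvg0 e0)).
  near=> n; rewrite prob_ge0//=; apply: prob_le => //.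
  - exact: measurable_weighted_abs_pow_le.
  - exact: measurable_dev.
  move=> x /= Su; have : v <= M q * \sum_(i < n) w i by near: n.
  by move=> vMn; rewrite distrC ger0_norm; lra.
exact: cvg_cst.
Unshelve. all: end_near. Qed.

Lemma prob_weighted_sum_ge_cvg0 (u v : R) : v < u ->
  (\forall n \near \oo, M q * \sum_(i < n) w i <= v) ->
  prob p [set x | u <= S q (@w n) x] @[n --> \oo] --> (0 : R).
Proof.
move=> uv vM; have e0 : 0 < u - v by rewrite subr_gt0.
apply: (@squeeze_cvgr _ _ _ _ (fun=> 0) _ _ _ _ _ (prob_dev_cvg0 e0)).
  near=> n; rewrite prob_ge0//=; apply: prob_le => //.
  - exact: measurable_weighted_abs_pow_ge.
  - exact: measurable_dev.
  move=> x /= Su; have : M q * \sum_(i < n) w i <= v by near: n.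
  by move=> vMn; rewrite ger0_norm; lra.
exact: cvg_cst.
Unshelve. all: end_near. Qed.

End weak_lln.

Definition mean_weight n : 'I_n -> R := fun=> n%:R^-1.

Lemma mean_weight_sqr_cvg0 :
  (\sum_(i < n) mean_weight i ^+ 2) @[n --> \oo] --> (0 : R).
Proof.
have E n : \sum_(i < n) mean_weight i ^+ 2 = n%:R^-1.
  rewrite /mean_weight sumr_const card_ord -[LHS]mulr_natr.
  case: n => [|n]; first by rewrite mulr0 invr0.
  by rewrite expr2 -mulrA mulVf ?mulr1// pnatr_eq0.
rewrite (_ : (fun n => _) = (fun n => n%:R^-1)); last exact/funext.
by have := @cvg_harmonic R; rewrite /harmonic (cvg_shiftS (fun n =>
  n%:R^-1 : R)).
Qed.

Lemma sum_mean_weight n : (0 < n)%N -> \sum_(i < n) mean_weight i = 1.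
Proof. by move=> n0; rewrite /mean_weight sumr_const card_ord -[LHS]mulr_natr
  mulVf// pnatr_eq0 -lt0n. Qed.

Lemma mean_abs_pow_sum r n (x : n.-tuple R) :
  S r (@mean_weight n) x = n%:R^-1 * abs_pow_sum r x.
Proof. by rewrite /weighted_sum -mulr_sumr. Qed.

(** The critical value is 1 because [pgauss_abs_moment1] makes the mean of [|X|^r] equal to 1. *)
Lemma prob_mean_le_cvg0 r (u : R) : 0 < r -> u < 1 ->
  prob r%:E [set x | S r (@mean_weight n) x <= u] @[n --> \oo] --> (0 : R).
Proof.
move=> r0 u1; apply: (@prob_weighted_sum_le_cvg0 _ _ mean_weight _ _ _ _ _ 1)
  => //.
- exact: ltW.
- by move=> n i; rewrite /mean_weight invr_ge0.
- exact: mean_weight_sqr_cvg0.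
- by near=> n; rewrite pgauss_abs_moment1// sum_mean_weight ?mulr1//; near: n;
    exact: nbhs_infty_gt.
Unshelve. all: end_near. Qed.

Lemma prob_mean_ge_cvg0 r (u : R) : 0 < r -> 1 < u ->
  prob r%:E [set x | u <= S r (@mean_weight n) x] @[n --> \oo] --> (0 : R).
Proof.
move=> r0 u1; apply: (@prob_weighted_sum_ge_cvg0 _ _ mean_weight _ _ _ _ _ 1)
  => //.
- exact: ltW.
- by move=> n i; rewrite /mean_weight invr_ge0.
- exact: mean_weight_sqr_cvg0.
- by near=> n; rewrite pgauss_abs_moment1// sum_mean_weight ?mulr1//; near: n;
    exact: nbhs_infty_gt.
Unshelve. all: end_near. Qed.

Lemma prob_pinfty n (A : set (n.-tuple R)) : measurable A ->
  prob +oo%E A = ball_frac +oo%E A.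
Proof.
move=> mA; have mB := @measurable_pball R +oo%E n (ltry 0).
rewrite /prob /ball_frac vol_pball_pinfty/=.
have -> : tuple_mean (pgauss_pdf +oo%E) \1_A =
    (((2 ^+ n)^-1)%:E * vol (A `&` pball n +oo%E))%E.
  transitivity (\int[@vol R n]_x (((2 ^+ n)^-1)%:E * (\1_(A `&` pball n +oo%E)
    x)%:E))%E; last first.
    rewrite ge0_integralZl//; first last.
    - apply/measurable_EFinP; apply: measurable_indic; exact: measurableI.
    by rewrite integral_indic ?setIT//; exact: measurableI.
  apply: eq_integral => x _; rewrite -EFinM; congr EFin.
  rewrite indicI/= mulrCA [LHS]mulrC; congr (_ * _).
  rewrite big_split/= prodr_const card_ord exprVn; congr (_ * _).
  have [xB|xB] := pselect (pball n +oo%E x).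
    rewrite [RHS]indicE mem_set//; move: xB; rewrite pball_pinftyE => xB.
    by apply: big1 => i _; rewrite indicE mem_set//= in_itv/= xB.
  rewrite [RHS]indicE memNset//; move: xB; rewrite pball_pinftyE =>
    /existsNP[i xi].
  by rewrite (bigD1 i)//= indicE memNset ?mul0r//= in_itv/=; exact/negP.
rewrite fineM//; last exact: vol_setI_pball_fin_num.
by rewrite mulrC.
Qed.

Lemma prob_cone r n (A : set (n.-tuple R)) : 0 < r -> measurable A -> cone A ->
  prob r%:E A = ball_frac r%:E A.
Proof. by move=> r0 mA cA; rewrite /prob (tuple_mean_coneE r0 mA cA). Qed.

(** Geometric decay in [n] when [u < 1]: the form in which concentration near the boundary is
    used. *)
Lemma ball_frac_small r n (u : R) : 0 < r -> 0 < u <= 1 ->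
  ball_frac r%:E [set x : n.-tuple R | abs_pow_sum r x <= u] = (u `^ r^-1) ^+ n.
Proof.
move=> r0 /andP[u0 u1]; rewrite /ball_frac.
have -> : [set x : n.-tuple R | abs_pow_sum r x <= u] `&` pball n r%:E =
    setT `&` [set x : n.-tuple R | abs_pow_sum r x <= u].
  rewrite setTI pball_finE//; apply/seteqP; split => x /=; first by case.
  by move=> xu; split => //; exact: le_trans u1.
rewrite (vol_cone r0 measurableT (@cone_setT R n) u0) setTI.
have [v v0 ->] := vol_pball_fin r0 n.
by rewrite -EFinM/= mulfK ?gt_eqF// -powR_mulrn ?powR_ge0// -powRrM mulrC.
Qed.

(** * Concentration of weighted q-sums on the ball *)

Section ball_concentration.
Variables (p : \bar R) (q : R) (w : forall n, 'I_n -> R).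
Hypotheses (p0 : (0 < p)%E) (q0 : 0 < q).
Hypothesis w0 : forall n (i : 'I_n), 0 <= w i.
Hypothesis w2 : (\sum_(i < n) w i ^+ 2) @[n --> \oo] --> (0 : R).
Local Notation M := (pgauss_abs_moment p q).
(** A typical point of the ball has coordinates of order [n^(-1/p)]; this factor restores the scale
    of the product measure, and equals 1 for [p = +oo]. *)
Local Notation T n := (n%:R `^ (q * fine (p^-1)%E)).

Let mTS (n : nat) v : measurable [set x | T n * S q (@w n) x <= v].
Proof.
rewrite -[X in measurable X]setTI; apply: measurable_fun_le => //.
by apply: measurable_funM => //; exact: measurable_weighted_abs_pow.
Qed.

(** The exponent [q / r] makes both sides homogeneous of degree [q]. *)
Lemma cone_weighted_abs_pow r n (k : R) : 0 < r ->
  cone [set x | S q (@w n) x <= k * S r (@mean_weight n) x `^ (q / r)].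
Proof.
move=> r0 a x a0 /=; have aq0 : 0 < a `^ q by rewrite powR_gt0.
rewrite !weighted_abs_pow_scale ?(ltW a0)// powRM ?powR_ge0//; last first.
  by apply: weighted_abs_pow_ge0 => i; rewrite /mean_weight invr_ge0.
rewrite -powRrM (_ : r * (q / r) = q) 1?[k * _]mulrCA; last first.
  by rewrite mulrC divfK// gt_eqF.
by rewrite ler_pM2l.
Qed.

Lemma measurable_weighted_abs_pow_cmp r n (k : R) :
  measurable [set x | S q (@w n) x <= k * S r (@mean_weight n) x `^ (q / r)].
Proof.
rewrite -[X in measurable X]setTI; apply: measurable_fun_le => //.
  exact: measurable_weighted_abs_pow.
apply: measurable_funM => //; apply: (measurableT_comp (measurable_powR _)).
exact: measurable_weighted_abs_pow.
Qed.

Lemma cone_weighted_abs_pow_rev r n (k : R) : 0 < r ->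
  cone [set x | k * S r (@mean_weight n) x `^ (q / r) <= S q (@w n) x].
Proof.
move=> r0 a x a0 /=; have aq0 : 0 < a `^ q by rewrite powR_gt0.
rewrite !weighted_abs_pow_scale ?(ltW a0)// powRM ?powR_ge0//; last first.
  by apply: weighted_abs_pow_ge0 => i; rewrite /mean_weight invr_ge0.
rewrite -powRrM (_ : r * (q / r) = q) 1?[k * _]mulrCA; last first.
  by rewrite mulrC divfK// gt_eqF.
by rewrite ler_pM2l.
Qed.

Lemma measurable_weighted_abs_pow_cmp_rev r n (k : R) :
  measurable [set x | k * S r (@mean_weight n) x `^ (q / r) <= S q (@w n) x].
Proof.
rewrite -[X in measurable X]setTI; apply: measurable_fun_le => //; last first.
  exact: measurable_weighted_abs_pow.
apply: measurable_funM => //; apply: (measurableT_comp (measurable_powR _)).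
exact: measurable_weighted_abs_pow.
Qed.

Let mTSgt (n : nat) v : measurable [set x | v < T n * S q (@w n) x].
Proof.
rewrite (_ : [set x | _] = ~` [set x | T n * S q (@w n) x <= v]).
  by apply: measurableC; exact: mTS.
by apply/seteqP; split => x /=; rewrite ltNge => /negP.
Qed.

Let powR_mean r n (x : n.-tuple R) : (0 < n)%N ->
  S r (@mean_weight n) x `^ (q / r) =
  (n%:R `^ (q * r^-1))^-1 * abs_pow_sum r x `^ (q / r).
Proof.
move=> n0; rewrite mean_abs_pow_sum powRM ?invr_ge0 ?abs_pow_sum_ge0//.
by rewrite -powR_inv1// -powRrM mulN1r powRN.
Qed.

(** For finite [p], outside the shrunken ball of level [h^-1] the event implies the cone [C n].
    Under the product measure, [C n] forces either the r-mean to be at least [h] or the q-sum to be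
    at most [c], and both are unlikely. *)
Lemma ball_frac_le_cvg0 (u : R^nat) (a b : R) : 0 < a < b ->
  (\forall n \near \oo, u n <= a) ->
  (\forall n \near \oo, b <= M * \sum_(i < n) w i) ->
  ball_frac p [set x | T n * S q (@w n) x <= u n] @[n --> \oo] --> (0 : R).
Proof.
move=> /andP[a0 ab] ua bM; have mT := mTS.
case: p p0 bM mT => [r| |]// r0 bM mT; last first.
  have mle (n : nat) v : measurable [set x | S q (@w n) x <= v].
    exact: measurable_weighted_abs_pow_le.
  have aM := @prob_weighted_sum_le_cvg0 +oo%E q w r0 (ltW q0) w0 w2 a b ab bM.
  apply: (@squeeze_cvgr _ _ _ _ (fun=> 0) _ _ _ _ _ aM); last exact: cvg_cst.
  near=> n; rewrite ball_frac_ge0//= prob_pinfty//; apply: ball_frac_le => //.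
  (* For [p = +oo] the factor is [n^0 = 1]. *)
  move=> x [/=]; rewrite mulr0 powRr0 mul1r => xu _.
  by apply: (le_trans xu); near: n.
rewrite lte_fin in r0.
have [c /andP[ac cb]] : exists c, a < c < b by exists ((a + b) / 2); lra.
have c0 : 0 < c by exact: lt_trans ac.
(* The factor [h^(q/r)] is lost twice, on leaving the shrunken ball and on bounding the r-mean by
   [h]; with this root the total loss is [c / a], turning [a] into [c < b]. *)
pose h := (c / a) `^ (r / (2 * q)).
have h1 : 1 < h.
  rewrite -(one_powR (r / (2 * q))) gt0_ltr_powR ?nnegrE ?divr_ge0 ?(ltW a0)
    ?(ltW c0)//.
    by rewrite divr_gt0// mulr_gt0.
  by rewrite ltr_pdivlMr// mul1r.
have h0 : 0 < h by exact: lt_trans h1.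
have hE : a * (h `^ (q / r) * h `^ (q / r)) = c.
  rewrite -powRD; last by rewrite (gt_eqF h0) implybT.
  rewrite /h -powRrM (_ : _ * (q / r + q / r) = 1); last first.
    by field; rewrite !gt_eqF.
  by rewrite powRr1 ?divr_ge0 ?(ltW a0) ?(ltW c0)// mulrC divfK// gt_eqF.
have mS (n : nat) v : measurable [set x | S q (@w n) x <= v].
  exact: measurable_weighted_abs_pow_le.
pose C n : set (n.-tuple R) := [set x | S q (@w n) x <=
  a * (h `^ (q / r)) * (S r (@mean_weight n) x) `^ (q / r)].
have mC n : measurable (C n) by exact: measurable_weighted_abs_pow_cmp.
have cC n : cone (C n) by exact: cone_weighted_abs_pow.
have small : (h^-1 `^ r^-1) ^+ n @[n --> \oo] --> (0 : R).
  apply: cvg_expr; rewrite ger0_norm ?powR_ge0//.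
  rewrite -[ltRHS](one_powR r^-1) gt0_ltr_powR ?invr_gt0 ?nnegrE ?invr_ge0
    ?(ltW h0)//.
  by rewrite invf_lt1.
have r0' : (0 < r%:E)%E by rewrite lte_fin.
have key1 := @prob_mean_ge_cvg0 r h r0 h1.
have key2 := @prob_weighted_sum_le_cvg0 r%:E q w r0' (ltW q0) w0 w2 c b cb bM.
apply: (@squeeze_cvgr _ _ _ _ (fun=> 0) (fun n => (h^-1 `^ r^-1) ^+ n +
    (prob r%:E [set x | h <= S r (@mean_weight n) x] +
     prob r%:E [set x | S q (@w n) x <= c]))); first last.
- rewrite -[X in _ --> X](addr0 (0 : R)); apply: cvgD => //.
  by rewrite -[X in _ --> X](addr0 (0 : R)); apply: cvgD.
- exact: cvg_cst.
near=> n; rewrite ball_frac_ge0//=.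
have n0 : (0 < n)%N by near: n; exact: nbhs_infty_gt.
apply: (@le_trans _ _ (ball_frac r%:E [set x : n.-tuple R | abs_pow_sum r x <=
  h^-1] +
   ball_frac r%:E (C n))).
  apply: ball_fracU => //.
    exact: measurable_abs_pow_sum_le.
  move=> x [/= xu xB]; have [|hx] := leP (abs_pow_sum r x) h^-1; first by left.
  right; rewrite /C/= powR_mean//.
  have Tn0 : 0 < n%:R `^ (q * r^-1) by rewrite powR_gt0// ltr0n.
  have una : u n <= a by near: n.
  move: xu; rewrite fine_invr -ler_pdivlMl// => /le_trans; apply.
  rewrite mulrCA ler_pM2l ?invr_gt0// (le_trans una)//
    -mulrA ler_peMr ?(ltW a0)//.
  rewrite -powRM ?abs_pow_sum_ge0 ?(ltW h0)// -[leLHS](one_powR (q / r)).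
  rewrite ge0_ler_powR ?nnegrE ?mulr_ge0 ?abs_pow_sum_ge0 ?(ltW h0) ?invr_ge0
    ?(ltW q0) ?(ltW r0)//.
  by rewrite -ler_pdivrMl// mulr1 ltW.
apply: lerD; first by rewrite ball_frac_small// invr_gt0 h0 invf_le1// ltW.
rewrite -prob_cone//; apply: probU => //.
  exact: measurable_weighted_abs_pow_ge.
move=> x Cx /=; have [|Zh] := leP h (S r (@mean_weight n) x); first by left.
right; apply: (le_trans Cx).
rewrite -[leRHS]hE mulrA ler_pM2l ?(mulr_gt0 a0 (powR_gt0 _ h0))//.
rewrite ge0_ler_powR ?nnegrE ?(ltW h0) ?(ltW Zh) ?divr_ge0 ?(ltW q0) ?(ltW
  r0)//.
by apply: weighted_abs_pow_ge0 => i; rewrite /mean_weight invr_ge0.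
Unshelve. all: end_near. Qed.

(** For finite [p], the bound on the p-sum in the ball turns the event into the cone [C n] directly,
    so the one remaining loss is an r-mean below [h]. *)
Lemma ball_frac_gt_cvg0 (u : R^nat) (a b : R) : 0 < b < a ->
  (\forall n \near \oo, a <= u n) ->
  (\forall n \near \oo, M * \sum_(i < n) w i <= b) ->
  ball_frac p [set x | u n < T n * S q (@w n) x] @[n --> \oo] --> (0 : R).
Proof.
move=> /andP[b0 ba] ua bM; have mT := mTSgt.
case: p p0 bM mT => [r| |]// r0 bM mT; last first.
  have mge (n : nat) v : measurable [set x | v <= S q (@w n) x].
    exact: measurable_weighted_abs_pow_ge.
  have aM := @prob_weighted_sum_ge_cvg0 +oo%E q w r0 (ltW q0) w0 w2 a b ba bM.
  apply: (@squeeze_cvgr _ _ _ _ (fun=> 0) _ _ _ _ _ aM); last exact: cvg_cst.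
  near=> n; rewrite ball_frac_ge0//= prob_pinfty//; apply: ball_frac_le => //.
  move=> x [/=]; rewrite mulr0 powRr0 mul1r => /ltW xu _.
  by apply: (le_trans _ xu); near: n.
rewrite lte_fin in r0.
have [c /andP[bc ca]] : exists c, b < c < a by exists ((a + b) / 2); lra.
have c0 : 0 < c by exact: lt_trans bc.
have a0 : 0 < a by exact: lt_trans ca.
(* The factor [h^(q/r)] is lost once here, hence the exponent [r / q] instead of [r / (2 * q)]. *)
pose h := (c / a) `^ (r / q).
have h1 : h < 1.
  rewrite -[ltRHS](one_powR (r / q)) gt0_ltr_powR ?nnegrE ?divr_ge0 ?(ltW a0)
    ?(ltW c0)//.
    by rewrite divr_gt0.
  by rewrite ltr_pdivrMr// mul1r.
have h0 : 0 < h by rewrite powR_gt0// divr_gt0.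
have hE : a * h `^ (q / r) = c.
  rewrite /h -powRrM (_ : _ * (q / r) = 1); last first.
    by field; rewrite !gt_eqF.
  by rewrite powRr1 ?divr_ge0 ?(ltW a0) ?(ltW c0)// mulrC divfK// gt_eqF.
pose C n : set (n.-tuple R) :=
  [set x | a * (S r (@mean_weight n) x) `^ (q / r) <= S q (@w n) x].
have mC n : measurable (C n) by exact: measurable_weighted_abs_pow_cmp_rev.
have cC n : cone (C n) by exact: cone_weighted_abs_pow_rev.
have r0' : (0 < r%:E)%E by rewrite lte_fin.
have key1 := @prob_mean_le_cvg0 r h r0 h1.
have key2 := @prob_weighted_sum_ge_cvg0 r%:E q w r0' (ltW q0) w0 w2 c b bc bM.
apply: (@squeeze_cvgr _ _ _ _ (fun=> 0) (fun n =>
    (prob r%:E [set x | S r (@mean_weight n) x <= h] +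
     prob r%:E [set x | c <= S q (@w n) x]))); first last.
- by rewrite -[X in _ --> X](addr0 (0 : R)); apply: cvgD.
- exact: cvg_cst.
near=> n; rewrite ball_frac_ge0//=.
have n0 : (0 < n)%N by near: n; exact: nbhs_infty_gt.
apply: (@le_trans _ _ (ball_frac r%:E (C n))).
  apply: ball_frac_le => //.
  move=> x [/= xu]; rewrite pball_finE//= => xB.
  rewrite /C/= powR_mean//.
  have Tn0 : 0 < n%:R `^ (q * r^-1) by rewrite powR_gt0// ltr0n.
  have una : a <= u n by near: n.
  move: xu; rewrite fine_invr -ltr_pdivrMl// => /ltW; apply: le_trans.
  rewrite mulrCA ler_pM2l ?invr_gt0// (le_trans _ una)// ler_piMr ?(ltW a0)//.
  rewrite -[leRHS](one_powR (q / r)).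
  by rewrite ge0_ler_powR ?nnegrE ?abs_pow_sum_ge0 ?divr_ge0 ?(ltW q0) ?(ltW
    r0).
rewrite -prob_cone//; apply: probU => //.
- exact: measurable_weighted_abs_pow_le.
- exact: measurable_weighted_abs_pow_ge.
move=> x Cx /=; have [|Zh] := leP (S r (@mean_weight n) x) h; first by left.
right; apply: (le_trans _ Cx).
rewrite -[leLHS]hE ler_pM2l//.
by rewrite ge0_ler_powR ?nnegrE ?(ltW h0) ?(ltW Zh) ?(ltW (lt_trans h0 Zh))
  ?divr_ge0 ?(ltW q0) ?(ltW r0).
Unshelve. all: end_near. Qed.

End ball_concentration.
End concentration.

(** * Asymptotics of the radii *)

Section radius.
Context {R : realType}.
Implicit Types (p : \bar R).

Section fin_exponent.
Variable r : R.
Hypothesis r0 : 0 < r.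
Let p0 : (0 < r%:E)%E. Proof. by rewrite lte_fin. Qed.
Local Notation c := (pgauss_norm_cst r).
Local Notation pdf := (pgauss_pdf r%:E).
Local Notation V n := (fine (vol (pball n r%:E))).

Lemma prob_setT n : prob r%:E [set: n.-tuple R] = 1.
Proof.
rewrite prob_cone// /ball_frac setTI divff// gt_eqF//.
exact: fine_vol_pball_gt0.
Qed.

Let vol_density n (A : set (n.-tuple R)) (s : R) : measurable A ->
  ((c ^+ n * expR (- (s / r)))%:E * vol A)%E =
  (\int[@vol R n]_x (c ^+ n * expR (- (s / r)) * \1_A x)%:E)%E.
Proof.
move=> mA; have c0 := ltW (pgauss_norm_cst_gt0 r0).
under [RHS]eq_integral do rewrite EFinM.
rewrite ge0_integralZl//; first last.
- by rewrite lee_fin mulr_ge0 ?expR_ge0 ?exprn_ge0.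
- by apply/measurable_EFinP; exact: measurable_indic.
by rewrite integral_indic ?setIT.
Qed.

(** Where the p-sum is at least [s], the density is at most [c^n * expR (- s / r)]. *)
Lemma prob_le_vol n (A : set (n.-tuple R)) (s : R) : measurable A ->
  A `<=` [set x | s <= abs_pow_sum r x] ->
  ((prob r%:E A)%:E <= (c ^+ n * expR (- (s / r)))%:E * vol A)%E.
Proof.
move=> mA As; have c0 := ltW (pgauss_norm_cst_gt0 r0).
rewrite vol_density// -prob_fin//; apply: ge0_le_integral => //.
- by move=> x _; rewrite lee_fin mulr_ge0// prodr_ge0// => i _;
    rewrite -lee_fin pgauss_pdf_ge0.
- apply: measurable_density_mul; [exact: measurable_pgauss_pdf|exact:
    measurable_indic].
- by apply/measurable_EFinP; apply: measurable_funM => //;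
    exact: measurable_indic.
move=> x _; rewrite prod_pgauss_pdf lee_fin indicE; case: (boolP (x \in A)) =>
  [|_]; last by rewrite !mulr0.
rewrite inE => /As /= sx; rewrite !mulr1 ler_wpM2l ?exprn_ge0// ler_expR lerN2.
by rewrite ler_pM2r ?invr_gt0.
Qed.

Lemma prob_ge_vol n (A : set (n.-tuple R)) (s : R) : measurable A ->
  A `<=` [set x | abs_pow_sum r x <= s] ->
  ((c ^+ n * expR (- (s / r)))%:E * vol A <= (prob r%:E A)%:E)%E.
Proof.
move=> mA As; have c0 := ltW (pgauss_norm_cst_gt0 r0).
rewrite vol_density// -prob_fin//; apply: ge0_le_integral => //.
- by move=> x _; rewrite lee_fin !mulr_ge0 ?expR_ge0 ?exprn_ge0.
- by apply/measurable_EFinP; apply: measurable_funM => //;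
    exact: measurable_indic.
- apply: measurable_density_mul; [exact: measurable_pgauss_pdf|exact:
    measurable_indic].
move=> x _; rewrite prod_pgauss_pdf lee_fin indicE; case: (boolP (x \in A)) =>
  [|_]; last by rewrite !mulr0.
rewrite inE => /As /= sx; rewrite !mulr1 ler_wpM2l ?exprn_ge0// ler_expR lerN2.
by rewrite ler_pM2r ?invr_gt0.
Qed.

Lemma vol_abs_pow_sum_le n (u : R) : 0 < u ->
  vol [set x : n.-tuple R | abs_pow_sum r x <= u] = (u `^ (n%:R / r) * V n)%:E.
Proof.
move=> u0; rewrite -[X in vol X]setTI (vol_cone r0 measurableT (@cone_setT R n)
  u0).
by rewrite setTI; have [v v0 ->] := vol_pball_fin r0 n.
Qed.

Let V0 n : 0 < V n. Proof. exact: fine_vol_pball_gt0. Qed.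

(** The density is at least [c^n * expR (- n / r)] where the p-sum is at most [n], and that set has
    probability at most 1. *)
Lemma norm_cst_vol_le1 n : (0 < n)%N ->
  c ^+ n * expR (- (n%:R / r)) * (n%:R `^ (n%:R / r) * V n) <= 1.
Proof.
move=> n0; rewrite -lee_fin EFinM -vol_abs_pow_sum_le ?ltr0n//.
have mA := @measurable_abs_pow_sum_le R r n n%:R.
apply: (le_trans (prob_ge_vol (s := n%:R) mA _)) => //.
by have := prob_le p0 mA measurableT (@subsetT _ _); rewrite prob_setT lee_fin.
Qed.

(** The shell where the p-sum lies between [n * (1 - e)] and [n * (1 + e)] eventually has mass at
    least 1/2. Its density is bounded by the value at the inner radius, its volume by that of the
    outer ball. *)
Lemma norm_cst_vol_ge_half (e : R) : 0 < e -> \forall n \near \oo,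
  2^-1 <= c ^+ n * expR (- (n%:R * (1 - e) / r)) *
    ((n%:R * (1 + e)) `^ (n%:R / r) * V n).
Proof.
move=> e0.
have e1 : 1 - e < 1 by lra.
have e2 : 1 < 1 + e by lra.
have k1 := @prob_mean_le_cvg0 R r (1 - e) r0 e1.
have k2 := @prob_mean_ge_cvg0 R r (1 + e) r0 e2.
(* Each of the two tails is allowed a quarter of the mass. *)
have q0 : 0 < 4^-1 :> R by rewrite invr_gt0.
have k1' := cvgr_le 0 k1 _ q0; have k2' := cvgr_le 0 k2 _ q0.
near=> n.
have P1 : prob r%:E [set x : n.-tuple R |
    weighted_sum (abs_pow r) (@mean_weight R n) x <= 1 - e] <= 4^-1.
  by near: n; exact: k1'.
have P2 : prob r%:E [set x : n.-tuple R |
    1 + e <= weighted_sum (abs_pow r) (@mean_weight R n) x] <= 4^-1.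
  by near: n; exact: k2'.
have n0 : (0 < n)%N by near: n; exact: nbhs_infty_gt.
have nR0 : 0 < n%:R :> R by rewrite ltr0n.
pose B1 : set (n.-tuple R) := [set x | weighted_sum (abs_pow r) (@mean_weight R
  n) x <= 1 - e].
pose B2 : set (n.-tuple R) := [set x | 1 + e <= weighted_sum (abs_pow r)
  (@mean_weight R n) x].
have mB1 : measurable B1 by exact: measurable_weighted_abs_pow_le.
have mB2 : measurable B2 by exact: measurable_weighted_abs_pow_ge.
pose A : set (n.-tuple R) := ~` (B1 `|` B2).
have mA : measurable A by apply: measurableC; exact: measurableU.
have PA : 2^-1 <= prob r%:E A.
  have : prob r%:E [set: n.-tuple R] <= prob r%:E A + prob r%:E (B1 `|` B2).
    by apply: probU => //; [exact: measurableU|rewrite setvU].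
  have : prob r%:E (B1 `|` B2) <= prob r%:E B1 + prob r%:E B2.
    by apply: probU => //; exact: measurableU.
  by rewrite prob_setT; move: P1 P2; rewrite -/B1 -/B2; lra.
rewrite -lee_fin; apply: (@le_trans _ _ (prob r%:E A)%:E).
  by rewrite lee_fin.
have AE x : A x -> n%:R * (1 - e) < abs_pow_sum r x < n%:R * (1 + e).
  rewrite /A /= /B1 /B2 /= mean_abs_pow_sum => /not_orP[/negP + /negP].
  by rewrite -!ltNge ltr_pdivlMl// ltr_pdivrMl// => -> ->.
apply: (le_trans (prob_le_vol (s := n%:R * (1 - e)) mA _)).
  by move=> x /AE /andP[/ltW].
rewrite [leRHS]EFinM lee_wpmul2l//.
  by rewrite lee_fin mulr_ge0 ?expR_ge0 ?exprn_ge0// ltW// pgauss_norm_cst_gt0.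
rewrite -vol_abs_pow_sum_le; last by rewrite mulr_gt0//; lra.
apply: le_measure; rewrite ?inE//; first exact: measurable_abs_pow_sum_le.
by move=> x /AE /andP[_ /ltW].
Unshelve. all: end_near. Qed.

(** In logarithms, divided by [n], the two volume bounds place [y n] between [ln c - r^-1] and
    [ln c - r^-1 + 2 * d / r + ln 2 / n]. *)
Lemma pradius_fin_cvg :
  n%:R `^ (- r^-1) * pradius n r%:E @[n --> \oo] --> c * expR (- r^-1).
Proof.
have c0 := pgauss_norm_cst_gt0 r0.
pose y n : R := - (r^-1 * ln n%:R) - n%:R^-1 * ln (V n).
have yE : \forall n \near \oo, expR (y n) = n%:R `^ (- r^-1) * pradius n r%:E.
  near=> n; have n0 : (0 < n)%N by near: n; exact: nbhs_infty_gt.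
  rewrite /y expRD /pradius /unit_vol_factor /powR !gt_eqF ?ltr0n//.
  by rewrite !mulNr.
apply: (cvg_trans (near_eq_cvg yE)).
rewrite -[c]lnK ?posrE// -expRD.
apply: (continuous_cvg _ (@continuous_expR R _)).
apply/cvgrPdist_le => e e0.
(* [d / r] occurs twice, from the inner radius and from [ln (1 + d) <= d]; together they make
   [e / 2], and [ln 2 / n] takes the other half. *)
pose d := e * r / 4; have d0 : 0 < d by rewrite divr_gt0// mulr_gt0.
near=> n.
have n0 : (0 < n)%N by near: n; exact: nbhs_infty_gt.
have nR0 : 0 < n%:R :> R by rewrite ltr0n.
have nz : n%:R != 0 :> R by rewrite gt_eqF.
have lnmain (s a : R) : 0 < a -> ln (c ^+ n * expR (- (s / r)) * (a `^ (n%:R /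
  r) * V n)) =
    n%:R * ln c - s / r + (n%:R / r * ln a + ln (V n)).
  move=> a0; rewrite !lnM ?posrE ?mulr_gt0 ?exprn_gt0 ?expR_gt0 ?powR_gt0//.
  by rewrite expRK ln_powR lnXn ?posrE// -[ln c *+ n]mulr_natl.
have U : n%:R * ln c - n%:R / r + (n%:R / r * ln n%:R + ln (V n)) <= 0.
  rewrite -lnmain// -ln1 ler_ln ?posrE ?norm_cst_vol_le1//.
  by rewrite !mulr_gt0 ?exprn_gt0 ?expR_gt0 ?powR_gt0.
have L : - ln 2 <= n%:R * ln c - n%:R * (1 - d) / r +
    (n%:R / r * (ln n%:R + d) + ln (V n)).
  have d1 : 0 < 1 + d by lra.
  have : 2^-1 <= c ^+ n * expR (- (n%:R * (1 - d) / r)) *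
    ((n%:R * (1 + d)) `^ (n%:R / r) * V n).
    by near: n; apply: norm_cst_vol_ge_half.
  rewrite -ler_ln ?posrE ?invr_gt0//; last first.
    by rewrite !mulr_gt0 ?exprn_gt0 ?expR_gt0 ?powR_gt0 ?mulr_gt0.
  rewrite lnV ?posrE// => /le_trans; apply.
  rewrite lnmain ?mulr_gt0// lnM ?posrE// lerD2l lerD2r ler_pM2l ?divr_gt0//.
  by rewrite lerD2l le_ln1Dx//; lra.
have l2n : ln 2 / n%:R <= e / 2.
  rewrite ler_pdivrMr// mulrC -ler_pdivrMr ?divr_gt0//.
  by near: n; exact: nbhs_infty_ger.
have dr : d / r = e / 4 by rewrite /d; field; rewrite gt_eqF.
rewrite ler_norml /y.
have nU : ln c - r^-1 + r^-1 * ln n%:R + n%:R^-1 * ln (V n) <= 0.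
  rewrite -(ler_pM2l nR0) mulr0 (le_trans _ U)// le_eqVlt; apply/orP; left;
    apply/eqP.
  by field; rewrite nz gt_eqF.
have nL : - (ln 2 / n%:R) <= ln c - r^-1 + d / r + r^-1 * ln n%:R + d / r +
  n%:R^-1 * ln (V n).
  rewrite -(ler_pM2l nR0) (le_trans _ (le_trans L _))//.
    by rewrite mulrN mulrCA divff// mulr1.
  rewrite le_eqVlt; apply/orP; left; apply/eqP.
  by field; rewrite nz gt_eqF.
by move: nU nL l2n; rewrite dr => *; lra.
Unshelve. all: end_near. Qed.

End fin_exponent.

Lemma pradius_pinfty_cvg :
  n%:R `^ (- 0) * pradius n +oo%E @[n --> \oo] --> (2^-1 : R).
Proof.
apply: cvg_near_cst; near=> n.
have n0 : (0 < n)%N by near: n; exact: nbhs_infty_gt.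
rewrite oppr0 powRr0 mul1r /pradius /unit_vol_factor vol_pball_pinfty/=.
rewrite -powR_mulrn// -powRrM mulrN mulfV ?pnatr_eq0 -?lt0n//.
by rewrite powR_inv1.
Unshelve. all: end_near. Qed.

Definition radius_limit p : R :=
  if p is r%:E then pgauss_norm_cst r * expR (- r^-1) else 2^-1.

Lemma radius_limit_gt0 p : (0 < p)%E -> 0 < radius_limit p.
Proof.
case: p => [r| |]//= r0.
by rewrite mulr_gt0 ?expR_gt0// pgauss_norm_cst_gt0// -lte_fin.
Qed.

Lemma pradius_cvg p : (0 < p)%E ->
  n%:R `^ (- fine (p^-1)%E) * pradius n p @[n --> \oo] --> radius_limit p.
Proof.
case: p => [r| |]//; last by move=> _; exact: pradius_pinfty_cvg.
rewrite lte_fin => r0; rewrite fine_invr; exact: pradius_fin_cvg.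
Qed.

Lemma radius_ratio_cvg p (q : R) : (0 < p)%E -> 0 < q ->
  radius_ratio p q n @[n --> \oo] --> radius_limit q%:E / radius_limit p.
Proof.
move=> p0 q0; apply: cvgM.
  exact: pradius_fin_cvg.
by apply: cvgV; [rewrite gt_eqF// radius_limit_gt0|exact: pradius_cvg].
Qed.

Lemma Apq_limE p (q : R) : (0 < p)%E -> 0 < q ->
  Apq p q = pgauss_abs_moment p q `^ (- q^-1) *
    (radius_limit q%:E / radius_limit p).
Proof.
move=> p0 q0; rewrite /Apq pgauss_momentE ?ltW//; congr (_ * _).
by apply/cvg_lim => //; exact: radius_ratio_cvg.
Qed.

End radius.

(** * Ellipsoids *)

Section main.
Context {R : realType}.
Implicit Types (p : \bar R).

(** Both sides are positive, so their logarithms are compared. With the Gamma values treated as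
    unknowns this is a rational identity in which the factors 2 of the normalisations cancel. For
    finite [p], [GammaS] first removes the shift in the moment, and its factor [(q + 1) / r] cancels
    the denominator [q + 1]. *)
Lemma Apq_formulaE p (q : R) : (0 < p)%E -> 0 < q ->
  pgauss_abs_moment p q `^ (- q^-1) * (radius_limit q%:E / radius_limit p) =
  Apq_formula p q.
Proof.
have lnc (a b : R) : 0 < a -> 0 < b ->
    ln ((2 * a `^ a^-1 * b)^-1 * expR (- a^-1)) =
    - (ln 2 + a^-1 * ln a + ln b) - a^-1.
  move=> a0 b0; rewrite lnM ?posrE ?expR_gt0 ?invr_gt0 ?mulr_gt0 ?powR_gt0//.
  by rewrite lnV ?posrE ?mulr_gt0 ?powR_gt0// !lnM ?posrE ?mulr_gt0 ?powR_gt0//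
    ln_powR expRK.
have c0 (a b : R) : 0 < a -> 0 < b ->
    0 < (2 * a `^ a^-1 * b)^-1 * expR (- a^-1).
  by move=> a0 b0; rewrite !mulr_gt0 ?invr_gt0 ?mulr_gt0 ?expR_gt0 ?powR_gt0.
case: p => [r| |]// p0 q0; have qV0 : 0 < q^-1 by rewrite invr_gt0.
all: have G0 : 0 < Gamma (1 + q^-1) by rewrite Gamma_gt0// addr_gt0.
all: have qq0 : 0 < q `^ q^-1 by rewrite powR_gt0.
- rewrite lte_fin in p0; have rV0 : 0 < r^-1 by rewrite invr_gt0.
  have g0 : 0 < Gamma (1 + r^-1) by rewrite Gamma_gt0// addr_gt0.
  have q1 : 0 < q + 1 by rewrite addr_gt0.
  have h0 : 0 < Gamma ((q + 1) / r) by rewrite Gamma_gt0// divr_gt0.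
  rewrite /= GammaS ?divr_gt0// ![_^-1 + 1]addrC /pgauss_norm_cst ![_^-1 +
    1]addrC.
  set g := Gamma (1 + r^-1) in g0 *; set G := Gamma (1 + q^-1) in G0 *.
  set h := Gamma _ in h0 *.
  clearbody g G h.
  rewrite (_ : r `^ (q / r) / (q + 1) * ((q + 1) / r * h / g) =
    r `^ (q / r) * h * r^-1 * g^-1); last by field; rewrite !gt_eqF.
  set k := r `^ (q / r) * h * r^-1 * g^-1.
  have k0 : 0 < k by rewrite !mulr_gt0 ?powR_gt0 ?invr_gt0.
  have rr0 : 0 < r `^ r^-1 by rewrite powR_gt0.
  have lnk : ln k = q / r * ln r + ln h - ln r - ln g.
    by rewrite !lnM ?posrE ?mulr_gt0 ?powR_gt0 ?invr_gt0// ln_powR !lnV.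
  clearbody k.
  have hq0 : 0 < h `^ q^-1 by rewrite powR_gt0.
  apply: ln_inj; rewrite ?posrE.
  + by rewrite mulr_gt0 ?divr_gt0 ?c0// powR_gt0.
  + by rewrite !mulr_gt0 ?invr_gt0 ?mulr_gt0 ?powR_gt0 ?expR_gt0// divr_gt0.
  rewrite lnM ?posrE ?powR_gt0 ?divr_gt0 ?c0//.
  rewrite ln_div ?posrE ?c0// !lnc// ln_powR lnk.
  rewrite [in RHS]lnM ?posrE ?powR_gt0 ?mulr_gt0 ?invr_gt0 ?expR_gt0 ?divr_gt0
    ?powR_gt0 ?mulr_gt0//.
  rewrite [in RHS]lnM ?posrE ?expR_gt0 ?divr_gt0 ?powR_gt0 ?mulr_gt0//.
  rewrite ln_div ?posrE ?powR_gt0 ?mulr_gt0// !ln_powR expRK lnM ?posrE//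
    ln_powR ln_div ?posrE//.
  by field; rewrite !gt_eqF.
- have q1 : 0 < q + 1 by rewrite addr_gt0.
  rewrite /= /pgauss_norm_cst [q^-1 + 1]addrC.
  set G := Gamma (1 + q^-1) in G0 *; clearbody G.
  have e0 : 0 < q * expR 1 by rewrite mulr_gt0 ?expR_gt0.
  apply: ln_inj; rewrite ?posrE.
  + by rewrite !mulr_gt0 ?invr_gt0 ?mulr_gt0 ?expR_gt0// powR_gt0// invr_gt0.
  + by rewrite mulr_gt0 ?invr_gt0// powR_gt0// divr_gt0.
  rewrite lnM ?posrE ?powR_gt0 ?divr_gt0 ?invr_gt0 ?c0//.
  rewrite ln_div ?posrE ?invr_gt0 ?c0// lnc// ln_powR !lnV ?posrE//.
  rewrite lnM ?posrE ?invr_gt0 ?powR_gt0 ?(divr_gt0 q1 e0)// lnV ?posrE//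
    ln_powR.
  rewrite ln_div ?posrE// lnM ?posrE ?expR_gt0// expRK.
  by field; rewrite gt_eqF.
Qed.

Lemma dilateE n (t : R) (A : set (n.-tuple R)) : 0 < t ->
  dilate t A = scale_tuple (fun=> t^-1) @^-1` A.
Proof.
move=> t0; have tn0 : t != 0 by rewrite gt_eqF.
apply/seteqP; split => [_ [x Ax <-]|y Ay] /=.
  rewrite (_ : scale_tuple _ _ = x)//; apply: eq_from_tnth => i.
  by rewrite !tnth_mktuple mulKf.
exists (scale_tuple (fun=> t^-1) y) => //; apply: eq_from_tnth => i.
by rewrite !tnth_mktuple mulVKf.
Qed.

Lemma measurable_scale_preimage n (s : 'I_n -> R) (A : set (n.-tuple R)) :
  measurable A -> measurable (scale_tuple s @^-1` A).
Proof.
move=> mA; rewrite -[X in measurable X]setTI.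
exact: measurable_scale_tuple.
Qed.

Lemma pellipsoidE n (q : R) (s : n.-tuple R) : 0 < q ->
  pellipsoid q%:E s = scale_tuple (fun i => (tnth s i)^-1) @^-1` pball n q%:E.
Proof.
move=> q0; rewrite pball_finE//; apply/funext => x /=; congr (is_true (_ <= 1)).
by apply: eq_bigr => i _; rewrite tnth_mktuple mulrC.
Qed.

Lemma vol_pellipsoid n (q : R) (s : n.-tuple R) : 0 < q ->
  (forall i, 0 < tnth s i) ->
  fine (vol (pellipsoid q%:E s)) =
  (\prod_(i < n) tnth s i) * fine (vol (pball n q%:E)).
Proof.
move=> q0 s0; have mB : measurable (pball n q%:E) by exact: measurable_pball.
have := @vol_scale R n (fun i => (tnth s i)^-1) _ _ mB.
rewrite -pellipsoidE// => <-; last by move=> i; rewrite invr_gt0.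
have P0 : 0 < \prod_(i < n) tnth s i by rewrite prodr_gt0.
rewrite prodfV.
have := @vol_ge0 R n (pellipsoid q%:E s).
case: (vol _) => [v| |]//= _.
  by rewrite mulrA divff ?mul1r// gt_eqF.
(* An infinite volume is read as 0 by [fine] on both sides. *)
by rewrite gt0_muley ?lte_fin ?invr_gt0//= mulr0.
Qed.

Lemma unit_vol_factor_pellipsoid n (q : R) (s : n.-tuple R) : 0 < q ->
  (forall i, 0 < tnth s i) ->
  unit_vol_factor (pellipsoid q%:E s) =
  ((\prod_(i < n) tnth s i) `^ n%:R^-1)^-1 * pradius n q%:E.
Proof.
move=> q0 s0; rewrite /unit_vol_factor vol_pellipsoid//.
have P0 : 0 <= \prod_(i < n) tnth s i by rewrite prodr_ge0// => i _; exact: ltW.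
by rewrite (powRM _ P0) ?(ltW (fine_vol_pball_gt0 _ _))// powRN.
Qed.

Lemma pradius_gt0 p n : (0 < p)%E -> 0 < pradius n p.
Proof. by move=> p0; rewrite powR_gt0// fine_vol_pball_gt0. Qed.

(* Normalised so that the weights sum to f_n^q, where f_n is the sequence whose
   limit is F. *)
Definition ellipsoid_weight n (q : R) (s : n.-tuple R) (i : 'I_n) : R :=
  ((\prod_(i < n) tnth s i) `^ n%:R^-1) `^ q * n%:R^-1 * tnth s i `^ (- q).

(** Dilation by [r_(n,p)] turns volume into a proportion of the ball. The geometric mean of the
    semi-axes goes into the weights, and the factor [n^(q/p)] is placed on both sides so that the
    threshold involves the convergent [radius_ratio]. *)
Lemma vol_unit_pballI n p (q t : R) (s : n.-tuple R) :
  (0 < n)%N -> (0 < p)%E -> 0 < q -> 0 < t -> (forall i, 0 < tnth s i) ->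
  vol (unit_pball n p `&` dilate t (unit_pellipsoid q%:E s)) =
  (ball_frac p [set x | n%:R `^ (q * fine (p^-1)%E) *
     weighted_sum (abs_pow q) (ellipsoid_weight q s) x <=
     (t * radius_ratio p q n) `^ q])%:E.
Proof.
move=> n0 p0 q0 t0 s0; have nR0 : 0 < n%:R :> R by rewrite ltr0n.
set P := \prod_(i < n) tnth s i; have P0 : 0 < P by rewrite prodr_gt0.
set rp := pradius n p; have rp0 : 0 < rp by exact: pradius_gt0.
set rq := pradius n q%:E; have rq0 : 0 < rq by exact: pradius_gt0.
pose G := P `^ n%:R^-1; have G0 : 0 < G by rewrite powR_gt0.
pose rho := unit_vol_factor (pellipsoid q%:E s).
have rhoE : rho = G^-1 * rq by exact: unit_vol_factor_pellipsoid.
have rho0 : 0 < rho by rewrite rhoE mulr_gt0 ?invr_gt0.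
rewrite /unit_pball /unit_pellipsoid !dilateE// -/rp -/rho.
set X := _ `&` _.
have mE : measurable (pellipsoid q%:E s).
  by rewrite pellipsoidE//; apply: measurable_scale_preimage;
    exact: measurable_pball.
have mX : measurable X.
  apply: measurableI; apply: measurable_scale_preimage;
    first exact: measurable_pball.
  exact: measurable_scale_preimage.
rewrite -(@vol_scale R n (fun=> rp) X (fun=> rp0) mX).
have [v v0 vE] := @vol_pball_gt0 R p n p0.
have rpn : \prod_(i < n) rp = v^-1.
  rewrite prodr_const card_ord /rp /pradius /unit_vol_factor vE/=.
  by rewrite -powR_mulrn ?powR_ge0// -powRrM mulNr mulVf ?gt_eqF// powR_inv1//
    ltW.
rewrite rpn /ball_frac vE [fine v%:E]/=.
set Y := [set x | _].
have -> : scale_tuple (fun=> rp) @^-1` X = Y `&` pball n p.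
  (* [k] is the total factor from a point of the ball to [pellipsoid q s]; both descriptions of the
     set reduce to [k^q * Q x <= 1]. *)
  have [k kE] : exists k, k = rho^-1 * (t^-1 * rp) by eexists.
  have k0 : 0 < k by rewrite kE !mulr_gt0 ?invr_gt0.
  have kq0 : 0 < k `^ q by rewrite powR_gt0.
  pose fp := fine (p^-1)%E; have nfp0 : 0 < n%:R `^ fp by rewrite powR_gt0.
  pose C := n%:R `^ (q * fp) * (G `^ q * n%:R^-1).
  have C0 : 0 < C by rewrite !mulr_gt0 ?powR_gt0 ?invr_gt0.
  pose Q (x : n.-tuple R) := \sum_(i < n) tnth s i `^ (- q) * abs_pow q (tnth x
    i).
  have CE : (t * radius_ratio p q n) `^ q = (k `^ q)^-1 * C.
    have -> : t * radius_ratio p q n = k^-1 * (n%:R `^ fp * (G * n%:R `^ (-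
      q^-1))).
      rewrite /radius_ratio -/rp -/rq -/fp powRN kE rhoE powRN.
      by field; rewrite !gt_eqF// powR_gt0.
    have kV0 : 0 <= k^-1 by rewrite invr_ge0 ltW.
    rewrite [in LHS](powRM _ kV0) ?mulr_ge0 ?powR_ge0 ?(ltW G0)//.
    rewrite ![in LHS]powRM ?mulr_ge0 ?powR_ge0 ?(ltW G0)//.
    have -> : k^-1 `^ q = (k `^ q)^-1.
      by rewrite -powR_inv1 ?(ltW k0)// -powRrM mulN1r powRN.
    have -> : (n%:R `^ (- q^-1)) `^ q = n%:R^-1 :> R.
      by rewrite -powRrM mulNr mulVf ?gt_eqF// powR_inv1 ?(ltW nR0).
    by rewrite -[(n%:R `^ fp) `^ q]powRrM [fp * q]mulrC.
  have SE x : weighted_sum (abs_pow q) (ellipsoid_weight q s) x = G `^ q *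
    n%:R^-1 * Q x.
    rewrite /weighted_sum /Q mulr_sumr; apply: eq_bigr => i _.
    by rewrite /ellipsoid_weight -/P -/G -mulrA.
  have YE x : Y x <-> k `^ q * Q x <= 1.
    rewrite /Y/= SE CE mulrA -/C [_ * C]mulrC ler_pM2l// -ler_pdivlMl//.
    by rewrite mulr1.
  have EE x : pellipsoid q%:E s (scale_tuple (fun=> rho^-1)
      (scale_tuple (fun=> t^-1) (scale_tuple (fun=>
        rp) x))) <-> k `^ q * Q x <= 1.
    rewrite /pellipsoid/= (_ : \sum_(i < n) _ = k `^ q * Q x)//.
    rewrite /Q mulr_sumr; apply: eq_bigr => i _; rewrite !tnth_mktuple.
    rewrite -[X in X `^ q](_ : `|k * (tnth s i)^-1 * tnth x i| = _); last first.
      by congr `|_|; rewrite kE; ring.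
    rewrite !normrM (gtr0_norm k0) normfV (gtr0_norm (s0 i)).
    rewrite !powRM ?mulr_ge0 ?invr_ge0 ?(ltW k0) ?(ltW (s0 i))// -mulrA.
    by rewrite -[_^-1]powR_inv1 ?(ltW (s0 i))// -powRrM mulN1r.
  have rpK x : scale_tuple (fun=> rp^-1) (scale_tuple (fun=> rp) x) = x.
    by apply: eq_from_tnth => i; rewrite !tnth_mktuple mulKf// gt_eqF.
  apply/seteqP; split => x; rewrite /X/= rpK.
    by move=> [xB /EE /YE].
  by move=> [/YE /EE].
have mY : measurable Y.
  rewrite /Y -[X in measurable X]setTI; apply: measurable_fun_le => //.
  by apply: measurable_funM => //; exact: measurable_weighted_abs_pow.
by rewrite mulrC EFinM fineK; [rewrite muleC|exact: vol_setI_pball_fin_num].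
Qed.
(** The origin is a degenerate box. Positive dimension matters: in dimension 0 the single point has
    mass 1. *)
Lemma vol_dilate0 n (A B : set (n.-tuple R)) : (0 < n)%N ->
  vol (A `&` dilate 0 B) = 0%E.
Proof.
move=> n0; pose z : n.-tuple R := [tuple 0 | _ < n].
have z0 : vol [set z] = 0%E.
  rewrite (_ : [set z] = [set x : n.-tuple R |
      forall i, tnth z i <= tnth x i <= tnth z i]); last first.
    apply/seteqP; split => [x -> i|x /= h]; first by rewrite lexx.
    by apply: eq_from_tnth => i; apply/esym/le_anti; exact: h.
  rewrite vol_box// (bigD1 (Ordinal n0))//= tnth_mktuple subrr mul0r//.
have : A `&` dilate 0 B `<=` [set z].
  move=> x [_ [y _ <-]] /=; apply: eq_from_tnth => i.
  by rewrite !tnth_mktuple mul0r.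
by move=> /subset_set1[] ->//; exact: vol0.
Qed.

(** Two reals, because the concentration statement wants a gap between its threshold and its mean,
    also for infinite [F]. *)
Lemma ereal_gt_between (x : R) (F : \bar R) : (x%:E < F)%E ->
  exists a b : R, [/\ x < a, a < b & (b%:E < F)%E].
Proof.
case: F => [f| |]//.
  rewrite lte_fin => xf; exists (x + (f - x) / 3), (x + 2 * (f - x) / 3).
  by rewrite lte_fin; split; lra.
by move=> _; exists (x + 1), (x + 2); rewrite ltry; split => //; lra.
Qed.

Lemma cvge_near_gt (f : R^nat) (F : \bar R) (b : R) :
  (f n)%:E @[n --> \oo] --> F -> (b%:E < F)%E -> \forall n \near \oo, b < f n.
Proof.
case: F => [r| |]// fF.
  by rewrite lte_fin => br; apply: (cvgr_gt r) => //; exact: (fine_cvg fF).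
move=> _; near=> n; rewrite -lte_fin; near: n; exact: (cvgey_gt fF).
Unshelve. all: end_near.
Qed.

(** * Limits of the volumes *)

Section limit.
Variables (p : \bar R) (q : R) (sigma : forall n : nat, n.-tuple R).
Hypotheses (p0 : (0 < p)%E) (q0 : 0 < q).
Hypothesis sigma0 : forall n (i : 'I_n), 0 < tnth (sigma n) i.
Hypothesis hlim : (\prod_(i < n) tnth (sigma n) i) `^ (2 * q / n%:R) *
  ((n%:R ^+ 2)^-1 * \sum_(i < n) tnth (sigma n) i `^ (- (2 * q)))
  @[n --> \oo] --> (0 : R).
Local Notation M := (pgauss_abs_moment p q).
Local Notation w := (fun n => @ellipsoid_weight n q (sigma n)).
Local Notation f := (fun n => (\prod_(i < n) tnth (sigma n) i) `^ n%:R^-1 *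
  (n%:R^-1 * \sum_(i < n) tnth (sigma n) i `^ (- q)) `^ q^-1).

Let w0 n (i : 'I_n) : 0 <= w n i.
Proof. by rewrite !mulr_ge0 ?powR_ge0 ?invr_ge0. Qed.

(** With these weights, the sum of squares is exactly the sequence of the second hypothesis of the
    theorem: it is the condition under which Chebyshev's bound vanishes. *)
Let w2 : (\sum_(i < n) w n i ^+ 2) @[n --> \oo] --> (0 : R).
Proof.
apply: (cvg_trans _ hlim); apply: near_eq_cvg; apply: nearW => n.
rewrite mulrA mulr_sumr; apply: eq_bigr => i _.
rewrite /ellipsoid_weight !exprMn; congr (_ * _ * _).
- rewrite -!powRrM -powR_mulrn ?powR_ge0// -powRrM; congr (_ `^ _).
  by rewrite mulrC [2 * q]mulrC mulrAC; ring.
- by rewrite exprVn.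
- by rewrite -powR_mulrn ?powR_ge0// -powRrM mulNr [q * _]mulrC.
Qed.

Let f_ge0 n : 0 <= f n.
Proof. by rewrite mulr_ge0 ?powR_ge0. Qed.

Let sum_w n : \sum_(i < n) w n i = f n `^ q.
Proof.
rewrite powRM ?powR_ge0// -[((_ * _) `^ _) `^ q]powRrM mulVf ?gt_eqF//.
rewrite powRr1; last by rewrite mulr_ge0 ?invr_ge0// sumr_ge0// => i _;
  rewrite powR_ge0.
by rewrite mulrA mulr_sumr.
Qed.

Let M0 : 0 < M. Proof. by rewrite pgauss_abs_moment_gt0// ltW. Qed.

Let A := Apq p q.
Let A0 : 0 < A.
Proof.
rewrite /A Apq_limE// mulr_gt0 ?powR_gt0// divr_gt0// radius_limit_gt0//.
Qed.

Let MA (a : R) : 0 <= a -> (M `^ q^-1 * a) `^ q = M * a `^ q.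
Proof.
by move=> a0; rewrite powRM ?powR_ge0// -powRrM mulVf ?gt_eqF// powRr1// ltW.
Qed.

(** The factor [M^(-1/q)] inside [A] cancels. After taking q-th powers the threshold tends to
    [M * (t * A)^q], while the mean of the weighted sum is [M * (f n)^q]; this is why [t * A] is
    compared with [F]. *)
Let ratio_cvg t : t * radius_ratio p q n @[n --> \oo] --> M `^ q^-1 * (t * A).
Proof.
rewrite (_ : M `^ q^-1 * (t * A) = t * (radius_limit q%:E / radius_limit p)).
  by apply: cvgMr; exact: radius_ratio_cvg.
by rewrite /A Apq_limE// mulrCA powRN mulVKf// gt_eqF// powR_gt0.
Qed.

Let ratio_ge0 t n : 0 <= t -> 0 <= t * radius_ratio p q n.
Proof.
move=> t0; rewrite mulr_ge0// divr_ge0// mulr_ge0 ?powR_ge0//.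
Qed.

Local Notation DE t n :=
  (unit_pball n p `&` dilate t (unit_pellipsoid q%:E (sigma n))).

Let volXE t : 0 < t -> \forall n \near \oo,
  (ball_frac p [set x | n%:R `^ (q * fine (p^-1)%E) *
     weighted_sum (abs_pow q) (w n) x <= (t * radius_ratio p q n) `^ q])%:E =
  vol (DE t n).
Proof.
move=> t0; near=> n; rewrite vol_unit_pballI//.
near: n; exact: nbhs_infty_gt.
Unshelve. all: end_near. Qed.

Lemma vol_cvg0 (F : \bar R) (t : R) : 0 <= t ->
  (f n)%:E @[n --> \oo] --> F -> ((t * A)%:E < F)%E ->
  vol (DE t n) @[n --> \oo] --> 0%E.
Proof.
rewrite le_eqVlt => /predU1P[<- _ _|t0 fF].
  (* At [t = 0] the dilation is not invertible and the rescaling does not apply; the intersection is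
     a null set as soon as [n > 0]. *)
  apply: cvg_near_cst; near=> n; apply: vol_dilate0.
  by near: n; exact: nbhs_infty_gt.
move=> /ereal_gt_between[a [b [ta ab bF]]].
have a0 : 0 < a by rewrite (le_lt_trans _ ta)// mulr_ge0 ?ltW.
apply: (cvg_trans (near_eq_cvg (volXE t0))).
apply: cvg_EFin; first exact: nearW.
apply: (@ball_frac_le_cvg0 R p q w p0 q0 w0 w2 _ (M * a `^ q) (M * b `^ q)).
- rewrite mulr_gt0 ?powR_gt0//= ltr_pM2l// gt0_ltr_powR ?nnegrE ?(ltW a0)//.
  by rewrite (ltW (lt_trans a0 ab)).
- have Ma : M `^ q^-1 * (t * A) < M `^ q^-1 * a by rewrite ltr_pM2l ?powR_gt0.
  have tr := cvgr_le _ (@ratio_cvg t) _ Ma.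
  near=> n; rewrite -MA ?(ltW a0)//.
  rewrite ge0_ler_powR ?nnegrE ?(ltW q0) ?ratio_ge0 ?(ltW t0)//.
    by rewrite mulr_ge0 ?powR_ge0 ?(ltW a0).
  by near: n; exact: tr.
- near=> n; rewrite sum_w ler_pM2l// ge0_ler_powR ?nnegrE ?(ltW q0)//.
    by rewrite (ltW (lt_trans a0 ab)).
  rewrite ltW//; near: n; exact: cvge_near_gt bF.
Unshelve. all: end_near. Qed.

Lemma vol_cvg1 (F : \bar R) (t : R) : 0 <= t -> (0 <= F)%E ->
  (f n)%:E @[n --> \oo] --> F -> (F < (t * A)%:E)%E ->
  vol (DE t n) @[n --> \oo] --> 1%E.
Proof.
case: F => [F| |]// t0 F0 fF; rewrite lte_fin => FtA.
rewrite lee_fin in F0.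
(* [t = 0] would give [F < 0]. *)
have {}t0 : 0 < t.
  by rewrite lt_neqAle t0 andbT; apply: contraTneq FtA => <-;
    rewrite mul0r -leNgt.
pose b := F + (t * A - F) / 3; pose a := F + 2 * (t * A - F) / 3.
have [Fb ba atA] : [/\ F < b, b < a & a < t * A] by rewrite /a /b; split; lra.
have b0 : 0 < b by exact: le_lt_trans Fb.
have a0 : 0 < a by exact: lt_trans ba.
apply: (cvg_trans (near_eq_cvg (volXE t0))).
apply: cvg_EFin; first exact: nearW.
have mTS n : measurable [set x | n%:R `^ (q * fine (p^-1)%E) *
     weighted_sum (abs_pow q) (w n) x <= (t * radius_ratio p q n) `^ q].
  rewrite -[X in measurable X]setTI; apply: measurable_fun_le => //.
  by apply: measurable_funM => //; exact: measurable_weighted_abs_pow.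
(* Passing to the complement leaves an upper deviation of the q-sum. *)
suff : (1 - ball_frac p [set x |
    (t * radius_ratio p q n) `^ q < n%:R `^ (q * fine (p^-1)%E) *
      weighted_sum (abs_pow q) (w n) x]) @[n --> \oo] --> (1 : R).
  apply: cvg_trans; apply: near_eq_cvg; apply: nearW => n /=.
  rewrite [RHS]ball_fracC//; congr (1 - ball_frac p _).
  by apply/seteqP; split => x /=; rewrite ltNge => /negP.
rewrite -[X in _ --> X](subr0 (1 : R)); apply: cvgB; first exact: cvg_cst.
apply: (@ball_frac_gt_cvg0 R p q w p0 q0 w0 w2 _ (M * a `^ q) (M * b `^ q)).
- rewrite mulr_gt0 ?powR_gt0//= ltr_pM2l// gt0_ltr_powR ?nnegrE ?(ltW a0)//.
  by rewrite (ltW b0).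
- have Ma : M `^ q^-1 * a < M `^ q^-1 * (t * A) by rewrite ltr_pM2l ?powR_gt0.
  have tr := cvgr_ge _ (@ratio_cvg t) _ Ma.
  near=> n; rewrite -MA ?(ltW a0)//.
  rewrite ge0_ler_powR ?nnegrE ?(ltW q0) ?ratio_ge0 ?(ltW t0)//.
    by rewrite mulr_ge0 ?powR_ge0 ?(ltW a0).
  by near: n; exact: tr.
- near=> n; rewrite sum_w ler_pM2l// ge0_ler_powR ?nnegrE ?(ltW q0) ?(ltW b0)//.
  near: n; apply: (cvgr_le F) => //; exact: (fine_cvg fF).
Unshelve. all: end_near. Qed.

End limit.
End main.

(** [Apq] is defined through [limn], which takes a default value on divergent sequences; the first
    conclusion certifies that a genuine limit is meant. *)
Theorem theorem1 (R : realType) (p : \bar R) (q : R)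
    (hp : (0 < p)%E) (hq : 0 < q)
    (sigma : forall n : nat, n.-tuple R)
    (hsigma : forall (n : nat) (i : 'I_n), 0 < tnth (sigma n) i)
    (F : \bar R) (hF0 : (0 <= F)%E)
    (hF : ((\prod_(i < n) tnth (sigma n) i) `^ n%:R^-1 *
           (n%:R^-1 * \sum_(i < n) tnth (sigma n) i `^ (- q)) `^ q^-1)%:E
          @[n --> \oo] --> F)
    (hlim : (\prod_(i < n) tnth (sigma n) i) `^ (2 * q / n%:R) *
            ((n%:R ^+ 2)^-1 * \sum_(i < n) tnth (sigma n) i `^ (- (2 * q)))
            @[n --> \oo] --> (0 : R)) :
  [/\ cvgn (radius_ratio p q),
      Apq p q = Apq_formula p q &
      forall t : R, 0 <= t ->
        (((t * Apq p q)%:E < F)%E ->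
           vol (unit_pball n p `&` dilate t (unit_pellipsoid q%:E (sigma n)))
             @[n --> \oo] --> 0%E) /\
        ((F < (t * Apq p q)%:E)%E ->
           vol (unit_pball n p `&` dilate t (unit_pellipsoid q%:E (sigma n)))
             @[n --> \oo] --> 1%E)].
Proof.
split.
- by apply/cvg_ex; eexists; exact: radius_ratio_cvg.
- by rewrite Apq_limE// Apq_formulaE.
move=> t t0; split => tF.
- exact: vol_cvg0 tF.
- exact: vol_cvg1 tF.
Qed.
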